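(* Let $g(x)=\alpha x^{q^k}+\beta x$ with $\alpha\in\mathbb{F}_{q^n}^*$, $\beta\in\mathbb{F}_{q^n}$, $1\le k<n$, and let $f(y)=\sum_{i=0}^d a_iy^{q^i}\in\mathbb{F}_{q^n}[y]$, $0\le d<n$, $a_d\ne0$, be not a monomial. Let $0\le h<n$ with $h>\ell$. Define \[m_h=\begin{cases}\ell & \text{if } \beta=0,\\ \max\{d,h\} & \text{if } \beta\ne0 \text{ and either } h\ne d \text{ or } \beta a_h\ne1,\\ \ell_3 & \text{if } h=d \text{ and } \beta a_h=1.\end{cases}\] If $k+\max\{m_h,d\}-\ell+1\le n/2$, then $L_g\cap\sigma(L_f)\ne\emptyset$.
   Context: Let $q$ be a prime power, $n\ge2$. For $f(y)=\sum_{i=0}^d a_iy^{q^i}$ with $a_d\neq0$: $\ell=\min\{i: a_i\ne0\}$; when $f$ is not a monomial (i.e. has at least two nonzero coefficients), $\ell_2=\min\{i>\ell: a_i\ne0\}$ and $\ell_3=\max\{i<d:a_i\ne0\}$. Coefficients $a_i$ with $i$ outside the support are $0$. For an integer $0\le h<n$: $L_g=\{\langle(x,g(x))\rangle_{\mathbb{F}_{q^n}}:x\in\mathbb{F}_{q^n}^*\}$ and $\sigma(L_f)=\{\langle(f(y),y^{q^h})\rangle_{\mathbb{F}_{q^n}}:y\in\mathbb{F}_{q^n}^*\}$, points of $\mathrm{PG}(1,q^n)$. *)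

(* Defs.v *)
From HB Require Import structures.
From mathcomp Require Import all_boot all_order all_algebra.
Set Implicit Arguments. Unset Strict Implicit. Unset Printing Implicit Defensive.
Import GRing.Theory.
Local Open Scope ring_scope.

Definition fq_sum (F : fieldType) (q d : nat) (a : nat -> F) (y : F) : F :=
  \sum_(i < d.+1) a i * y ^+ (q ^ i).

Definition gbin (F : fieldType) (q k : nat) (alpha beta : F) (x : F) : F :=
  alpha * x ^+ (q ^ k) + beta * x.

Definition ell (F : fieldType) (a : nat -> F) (d : nat) : nat :=
  find (fun i => a i != 0) (iota 0 d.+1).

Definition ell3 (F : fieldType) (a : nat -> F) (d : nat) : nat :=
  \max_(i < d | a i != 0%R) (i : nat).

Definition m_h (F : fieldType) (a : nat -> F) (d h : nat) (beta : F) : nat :=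
  if beta == 0 then ell a d
  else if (h != d) || (beta * a h != 1) then maxn d h
  else ell3 a d.

(* <(u1,u2)> = <(v1,v2)> as points of PG(1,F) for nonzero vectors:
   the vectors are F-proportional *)
Definition same_point (F : fieldType) (u1 u2 v1 v2 : F) : Prop :=
  exists lam : F, lam != 0 /\ u1 = lam * v1 /\ u2 = lam * v2.

(* Main.v *)
(** After the substitution [y -> y ^+ (q ^ l)], with [l = ell a d], one may assume
    [l = 0].  The two linear sets then meet as soon as [U = A / B], with
    [A = 'X^(q ^ h) - beta *: f] and [B = alpha *: f], takes a nonzero
    [(q ^ k - 1)]-th power as a value; [f] and (for [beta != 0]) [A] are separable
    because their derivatives are constant.  With [Q = #|F|], counting such values
    with the multiplicative characters [chi] of order dividing
    [e = gcd (q ^ k - 1) (Q - 1)] reduces this to Weil's bound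
    [(D - 1) * sqrt Q] for the sum of the [chi (U y)], where [D] is the degree of a
    modulus [M0] vanishing at the zeros and poles of [U].  For [q = 2] the
    hypothesis leaves no room for a worse constant.  The bound is obtained in the classical way: the
    L-function of [chi] and [U] is a polynomial of degree [< D], so that the character
    sums over the extensions of degree [s] of [F] are, up to sign, the power sums of
    its inverse roots, and Stepanov's method bounds these sums by a constant times
    [sqrt (Q ^ s)] for even [s], which forces the inverse roots to have modulus at most
    [sqrt Q].  All extensions of [F] are taken inside an algebraic closure [K]. *)

Require Import Defs.
From HB Require Import structures.
From mathcomp Require Import all_boot all_order all_algebra all_solvable all_field.
From mathcomp Require Import ring zify.
Set Implicit Arguments. Unset Strict Implicit. Unset Printing Implicit Defensive.
Import Order.TTheory GRing.Theory Num.Theory.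
Local Open Scope ring_scope.

(** * Linear algebra and elementary estimates *)

Lemma poly_dependence (K : fieldType) (I : finType) (b : I -> {poly K}) (N : nat) :
  (forall i, (size (b i) <= N)%N) -> (N < #|I|)%N ->
  exists c : I -> K, (exists i, c i != 0) /\ \sum_i c i *: b i = 0.
Proof.
move=> sb ltN.
pose M : 'M[K]_(#|I|, N) := \matrix_(u < #|I|) poly_rV (b (enum_val u)).
have nfree : kermx M != 0.
  rewrite kermx_eq0 /row_free; apply: contraL ltN => /eqP eM.
  by rewrite -leqNgt -eM rank_leq_col.
pose v := nz_row (kermx M).
have v0 : v != 0 by rewrite nz_row_eq0.
have vM : v *m M = 0 by apply/sub_kermxP/nz_row_sub.
exists (fun i => v 0 (enum_rank i)); split.
  have [u vu] : exists u, v 0 u != 0.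
    apply/existsP; apply: contraNT v0 => /existsPn vz.
    by apply/eqP/rowP => u; rewrite mxE; apply/eqP; rewrite -[_ == _]negbK vz.
  by exists (enum_val u); rewrite enum_valK.
set s := \sum_i _.
have szs : (size s <= N)%N.
  apply: (leq_trans (size_sum _ _ _)); apply/bigmax_leqP => i _.
  exact: leq_trans (size_scale_leq _ _) (sb i).
rewrite -(poly_rV_K szs); suff -> : poly_rV s = 0 :> 'rV_N by rewrite linear0.
rewrite -vM linear_sum mulmx_sum_row (reindex_onto enum_val enum_rank) /=.
  apply: eq_big => [u|u _]; first by rewrite enum_valK eqxx.
  by rewrite linearZ /= enum_valK rowK.
by move=> i _; rewrite enum_rankK.
Qed.

(** After division by the lowest power of ['X - rho%:P] among the terms with nonzero coefficient,
    only that term survives at [rho], because the orders are distinct. *)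
Lemma combination_neq0 (K : fieldType) (I : finType) (rho : K) (n : I -> nat)
    (r : I -> {poly K}) (c : I -> K) :
  injective n -> (forall i, (r i).[rho] != 0) -> (exists i, c i != 0) ->
  \sum_i c i *: (('X - rho%:P) ^+ n i * r i) != 0.
Proof.
move=> n_inj r0 [i1 ci1].
pose i0 := [arg min_(i < i1 | c i != 0) n i].
have [ci0 min0] : c i0 != 0 /\ forall j, c j != 0 -> (n i0 <= n j)%N.
  by rewrite /i0; case: arg_minnP.
have -> : \sum_i c i *: (('X - rho%:P) ^+ n i * r i) = ('X - rho%:P) ^+ n i0 *
   \sum_i c i *: (('X - rho%:P) ^+ (n i - n i0) * r i).
  rewrite big_distrr; apply: eq_bigr => i _ /=.
  have [->|ci] := eqVneq (c i) 0; first by rewrite !scale0r mulr0.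
  by rewrite -scalerAr mulrA -exprD subnKC // min0.
rewrite mulf_neq0 ?expf_neq0 ?polyXsubC_eq0 //.
apply: contraTneq (mulf_neq0 ci0 (r0 i0)) => /(congr1 (horner^~ rho)).
rewrite horner0 horner_sum (bigD1 i0) //= big1 => [|i ne].
  by rewrite addr0 subnn expr0 mul1r hornerZ => ->; rewrite eqxx.
have [->|ci] := eqVneq (c i) 0; first by rewrite scale0r horner0.
have nei : n i != n i0 by apply: contra ne => /eqP/n_inj->.
have ltn : (n i0 < n i)%N by rewrite ltn_neqAle eq_sym nei min0.
rewrite hornerZ hornerM horner_exp hornerXsubC subrr expr0n subn_eq0 leqNgt ltn.
by rewrite mul0r mulr0.
Qed.

(** If [0 < b < a], Bernoulli's inequality makes [(a / b) ^+ s] grow at least linearly in [s], hence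
    past [C]. *)
Lemma real_expr_bounded (a b C : algC) :
  0 <= a -> 0 <= b -> (forall s, a ^+ s.+1 <= C * b ^+ s.+1) -> a <= b.
Proof.
move=> a0 b0 bound; rewrite real_leNgt ?ger0_real //; apply/negP => ltba.
have [b00|bn0] := eqVneq b 0.
  have := bound 0; rewrite b00 expr1 mulr0 => /le_gtF.
  by rewrite -{1}b00 ltba.
have bp : 0 < b by rewrite lt_def bn0.
pose d := a / b - 1.
have dp : 0 < d by rewrite subr_gt0 ltr_pdivlMr // mul1r.
have bern s : 1 + s%:R * d <= (a / b) ^+ s.
  elim: s => [|s IH]; first by rewrite mul0r addr0 expr0.
  have ab : a / b = 1 + d by rewrite /d; ring.
  rewrite exprS [X in _ <= X * _]ab.
  apply: le_trans (ler_wpM2l _ IH); last by rewrite addr_ge0 ?ler01 ?ltW.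
  rewrite -subr_ge0.
  have -> : (1 + d) * (1 + s%:R * d) - (1 + s.+1%:R * d) = s%:R * (d * d).
    by rewrite -(addn1 s) natrD; ring.
  by rewrite mulr_ge0 ?ler0n // mulr_ge0 // ltW.
have C0 : 0 <= C.
  by have := bound 0; rewrite !expr1 => h; rewrite -(pmulr_lge0 _ bp) (le_trans a0).
have CR : C / d \is Num.real by rewrite ger0_real ?divr_ge0 // ltW.
pose s := Num.truncn (C / d).
have ltCs : C / d < s.+1%:R by apply: real_truncnS_gt.
have := bern s.+1; rewrite expr_div_n ler_pdivlMr ?exprn_gt0 // => h.
have := le_trans h (bound s); rewrite ler_pM2r ?exprn_gt0 // => /le_gtF.
move: ltCs; rewrite ltr_pdivrMr // => ltCs.
rewrite (lt_le_trans ltCs) //.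
apply: (@le_trans _ _ (s.+1%:R * d)); last by rewrite lerDr ler01.
by rewrite ler_pM2r // ler_nat.
Qed.

(** [L] vanishes at every element of [rs] other than [x], so combining consecutive power sums with
    the coefficients of [L] isolates the contribution of [x]. *)
Lemma power_sum_bound (rs : seq algC) (B C : algC) :
  0 <= B ->
  (forall s, `|\sum_(x <- rs) x ^+ s.+1| <= C * B ^+ s.+1) ->
  forall x, x \in rs -> `|x| <= B.
Proof.
move=> B0 bound x xrs.
pose L : {poly algC} := \prod_(y <- undup rs | y != x) ('X - y%:P).
have Lx : L.[x] != 0.
  rewrite horner_prod prodf_seq_neq0; apply/allP => y _; apply/implyP => yx.
  by rewrite hornerXsubC subr_eq0 eq_sym.
have L0 y : y \in rs -> y != x -> L.[y] = 0.
  move=> yrs yx; rewrite horner_prod (big_rem y) /=; last by rewrite mem_undup.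
  by rewrite yx hornerXsubC subrr mul0r.
pose m := (count_mem x rs)%:R * `|L.[x]|.
have m0 : 0 < m.
  by rewrite mulr_gt0 ?normr_gt0 // ltr0n -has_count has_pred1.
have key s : \sum_(j < size L) L`_j * (\sum_(y <- rs) y ^+ (s.+1 + j)) =
             x ^+ s.+1 * ((count_mem x rs)%:R * L.[x]).
  under eq_bigr do rewrite big_distrr /=.
  rewrite exchange_big /= (eq_big_seq (fun y => (y == x)%:R * (x ^+ s.+1 * L.[x]))).
    rewrite -big_distrl /= -natr_sum -big_mkcond sum1_count; ring.
  move=> y yrs; have [->|yx] := eqVneq y x.
    rewrite mul1r horner_coef big_distrr; apply: eq_bigr => j _ /=.
    by rewrite exprD; ring.
  transitivity (y ^+ s.+1 * L.[y]); last by rewrite L0 // mulr0 mul0r.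
  rewrite horner_coef big_distrr.
  by apply: eq_bigr => j _ /=; rewrite exprD; ring.
pose C' := (\sum_(j < size L) `|L`_j| * (C * B ^+ j)) / m.
apply: (@real_expr_bounded _ _ C') => // s.
rewrite -normrX /C' mulrAC ler_pdivlMr // /m.
rewrite -[X in _ * (X * _)]normr_nat -!normrM -key.
rewrite (le_trans (ler_norm_sum _ _ _)) // big_distrl ler_sum // => j _ /=.
rewrite normrM -mulrA ler_wpM2l // -mulrA -exprD.
by apply: le_trans (bound (s + j)%N) _; rewrite -addSn addnC.
Qed.

Lemma newton_power_sums (R : comNzRingType) (rs : seq R) (N : nat) :
  let E := \prod_(x <- rs) (1 - x *: 'X) : {poly R} in
  E`_N *+ N = - \sum_(i < N) (\sum_(x <- rs) x ^+ i.+1) * E`_(N - i.+1).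
Proof.
move=> E.
(* [P r] is the generating series of the power sums cut at degree [N]. The logarithmic derivative of
   [E] is thus taken modulo ['X^(N.+1)], without formal power series. *)
pose P (r : seq R) : {poly R} := \sum_(i < N) (\sum_(x <- r) x ^+ i.+1) *: 'X^(i.+1).
suff [G eqG] : exists G : {poly R}, 'X * E^`() + E * P rs = 'X^(N.+1) * G.
  move/(congr1 (fun p : {poly R} => p`_N)): eqG.
  rewrite coefXnM ltnSn coefD coefXM coef_deriv mulr_sumr coef_sum => /eqP.
  rewrite addr_eq0 => /eqP H.
  have -> : E`_N *+ N = (if N == 0%N then 0 else E`_N.-1.+1 *+ N.-1.+1).
    by case: (N).
  rewrite H; congr (- _); apply: eq_bigr => i _.
  by rewrite -scalerAr coefZ coefMXn ltnNge ltn_ord.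
rewrite /E; elim: rs {E} => [|x r [G IH]].
  exists 0; rewrite big_nil derivC mulr0 add0r mul1r mulr0 /P big1 // => i _.
  by rewrite big_nil scale0r.
have geo : (1 - x *: 'X) * (\sum_(i < N) x ^+ i.+1 *: 'X^(i.+1)) =
   x *: 'X - x ^+ N.+1 *: 'X^(N.+1).
  elim: (N) => [|M IHM]; first by rewrite big_ord0 mulr0 !expr1 subrr.
  rewrite big_ord_recr /= mulrDr IHM [x ^+ M.+2]exprS ['X^(M.+2)]exprS.
  rewrite mulrBl mul1r -scalerAl -scalerAr scalerA; ring.
pose Er := \prod_(y <- r) (1 - y *: 'X) : {poly R}.
exists ((1 - x *: 'X) * G - x ^+ N.+1 *: Er).
have PE : P (x :: r) = P r + \sum_(i < N) x ^+ i.+1 *: 'X^(i.+1).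
  rewrite /P -big_split; apply: eq_bigr => i _ /=.
  by rewrite big_cons scalerDl addrC.
rewrite big_cons -/Er PE derivM derivB derivZ derivX derivE sub0r.
have -> : x%:A = x%:P :> {poly R} by rewrite -alg_polyC.
rewrite -!mul_polyC in geo *.
rewrite -/Er in IH.
transitivity ((1 - x%:P * 'X) * ('X * Er^`() + Er * P r) - x%:P * 'X * Er + Er * ((1 - x%:P * 'X) * \sum_(i < N) x ^+ i.+1 *: 'X^(i.+1))).
  by ring.
by rewrite IH geo; ring.
Qed.

(** The [c j] are the coefficients of a polynomial with constant term 1, and [rs] lists its inverse
    roots. Up to sign, Newton's identities for [rs] are the given recursion, whose term with [c 0]
    determines [S s.+1] by strong induction. *)
Lemma recursion_power_sums (c S : nat -> algC) (D : nat) :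
  (0 < D)%N -> c 0 = 1 -> (forall j, (D <= j)%N -> c j = 0) ->
  (forall s, c s *+ s = \sum_(i < s) S i.+1 * c (s - i.+1)%N) ->
  exists2 rs : seq algC, (size rs < D)%N &
    forall s, S s.+1 = - \sum_(x <- rs) x ^+ s.+1.
Proof.
move=> D0 c0 cD rec.
pose C := \poly_(j < D) c j.
have Cc j : C`_j = c j by rewrite coef_poly; case: ltnP => // /cD.
have [ys Cys] := closed_field_poly_normal C.
have C0 : C != 0 by apply: contra_neq (oner_neq0 algC) => C0; rewrite -c0 -Cc C0 coef0.
have ys0 y : y \in ys -> y != 0.
  move=> yin; apply: contra_neq (oner_neq0 algC) => y0.
  have /rootP : root C y by rewrite Cys rootZ ?lead_coef_eq0 // root_prod_XsubC.
  by rewrite y0 horner_coef0 Cc c0.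
pose rs := [seq y^-1 | y <- ys].
have CE : C = \prod_(x <- rs) (1 - x *: 'X).
  rewrite [LHS]Cys -[lead_coef C]mulr1.
  have e1 : 1 = (lead_coef C) * \prod_(y <- ys) (- y).
    have := horner_coef0 C; rewrite {1}Cys Cc c0 hornerZ horner_prod => e1; rewrite -[LHS]e1.
    congr (_ * _); apply: eq_bigr => y _; by rewrite hornerXsubC sub0r.
  have -> : \prod_(x <- rs) (1 - x *: 'X) = \prod_(y <- ys) ((- y^-1) *: ('X - y%:P)).
    rewrite big_map; apply: eq_big_seq => y yin.
    by rewrite scalerBr scale_polyC mulNr mulVf ?ys0 // polyCN opprK scaleNr addrC.
  rewrite scaler_prod mulr1; congr (_ *: _).
  rewrite -[LHS]mulr1 -[X in _ * X](_ : \prod_(y <- ys) (- y) * \prod_(y <- ys) (- y^-1) = 1).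
    by rewrite mulrA -e1 mul1r.
  rewrite -big_split big1_seq //= => y yin.
  by rewrite mulrNN mulfV ?ys0.
exists rs.
  rewrite size_map -(size_prod_XsubC ys id) -(@size_scale _ (lead_coef C)) ?lead_coef_eq0 //.
  by rewrite -Cys size_poly.
elim/ltn_ind => s IH.
have /= := newton_power_sums rs s.+1; rewrite -CE Cc rec.
rewrite !big_ord_recr /= subnn Cc c0 !mulr1 opprD -sumrN.
rewrite (eq_bigr (fun i : 'I_s => - ((\sum_(x <- rs) x ^+ i.+1) * C`_(s.+1 - i.+1)))).
  by move/addrI.
by move=> i _; rewrite IH // mulNr Cc.
Qed.

(** * Stepanov's method *)

Lemma size_mul_leqS (R : nzSemiRingType) (u v : {poly R}) (a b : nat) :
  (size u <= a.+1)%N -> (size v <= b.+1)%N -> (size (u * v)%R <= (a + b).+1)%N.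
Proof. by move=> su sv; apply: leq_trans (size_polyMleq u v) _; lia. Qed.

Lemma size_exp_leqS (R : nzSemiRingType) (u : {poly R}) (a n : nat) :
  (size u <= a.+1)%N -> (size (u ^+ n) <= (n * a).+1)%N.
Proof.
move=> su; elim: n => [|n IH]; first by rewrite expr0 size_polyC; case: (_ != _).
by rewrite exprS mulSn size_mul_leqS.
Qed.

Lemma sum_expr_pchar (R : comNzRingType) (n : nat) (I : Type) (r : seq I)
    (G : I -> R) : [pchar R].-nat n ->
  (\sum_(i <- r) G i) ^+ n = \sum_(i <- r) G i ^+ n.
Proof.
move=> pn; have n0 : (0 < n)%N by case/andP: pn.
by apply: (big_morph (fun x => x ^+ n)) => [x y|]; rewrite ?exprDn_pchar // expr0n gtn_eqF.
Qed.

Section Stepanov.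
Variables (K : closedFieldType) (P e H delta : nat) (A B B1 : {poly K}) (rho zeta : K).
Hypothesis pcharP : [pchar K].-nat P.
Hypotheses (e_gt1 : (1 < e)%N) (H_gt0 : (0 < H)%N) (PE : P = (e * H).+1).
Hypotheses (sA : (size A <= delta.+1)%N) (sB : (size B <= delta.+1)%N).
Hypotheses (BE : B = ('X - rho%:P) * B1) (B1rho : B1.[rho] != 0) (Arho : A.[rho] != 0).

(** Large enough for the [e * J * H] unknowns to outnumber the coefficients in [stepanov_relation],
    and small enough for [Psi] to have degree at most [P * P / e + 3 * delta * P]. *)
Let J := (H + 2 * delta)%N.
Let I : finType := ('I_e * 'I_J * 'I_H)%type.
Implicit Type x : I.
Let co x := (e.-1 - x.1.1)%N.

(** [P] stands for [sqrt (Q ^ s)].  The auxiliary polynomial [Psi] of [stepanov] has order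
    [n x] at [rho] in its [x]-th term, and these orders are pairwise distinct, so that
    [Psi != 0].  On the points counted in [stepanov], where [y ^+ (P * P) = y], the power
    [Psi.[y] ^+ P] is, up to a nonzero factor, the value at [y] of the combination below,
    whose coefficients are the [P]-th powers of those of [Psi].  No derivatives are needed
    since vanishing to order one suffices. *)
Lemma stepanov_relation :
  exists c : I -> K, (exists x, c x != 0) /\
   \sum_x c x *: (zeta ^+ x.1.1 *: (('X - rho%:P) ^+ (x.2 * P) *
      ('X - (rho ^+ (P * P))%:P) ^+ x.1.2 *
      (B ^+ (x.1.1 * H) * A ^+ (co x * H)))) = 0.
Proof.
apply: (@poly_dependence _ _ _ (H.-1 * P + J.-1 + e.-1 * H * delta).+1) => [[[t j] i]|].
  rewrite /co /=; apply: leq_trans (size_scale_leq _ _) _.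
  have h1 := eq_leq (size_exp_XsubC (i * P) rho).
  have h2 := eq_leq (size_exp_XsubC j (rho ^+ (P * P))).
  have h3 := size_mul_leqS (size_exp_leqS (t * H) sB) (size_exp_leqS ((e.-1 - t) * H) sA).
  apply: leq_trans (size_mul_leqS (size_mul_leqS h1 h2) h3) _.
  rewrite ltnS -!mulnDl subnKC; last by have := ltn_ord t; lia.
  rewrite leq_add2r leq_add ?leq_mul2r //; first by have := ltn_ord i; lia.
  by have := ltn_ord j; lia.
rewrite !card_prod !card_ord PE /J; move: e_gt1 H_gt0.
case: (e) => [|[|e']] //; case: (H) => [|H'] // _ _.
by rewrite /=; nia.
Qed.

(** A mixed-radix expansion: [x.2 < H] and [x.2 + co x * H < P], so the quotient by [P] and the
    residue modulo [H] recover the indices. *)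
Lemma stepanov_order_inj :
  injective (fun x : I => x.2 + x.1.2 * P + co x * H)%N.
Proof.
pose n (x : I) := (x.2 + x.1.2 * P + co x * H)%N.
have small (x : I) : (x.2 + co x * H < P)%N.
  rewrite PE ltnS; have := ltn_ord x.2; have : (co x <= e.-1)%N by rewrite leq_subr.
  by move: e_gt1; nia.
have nE (x : I) : n x = (x.1.2 * P + (x.2 + co x * H))%N by rewrite /n; lia.
move=> x y; rewrite -/(n x) -/(n y) !nE => eqn.
have eqj : x.1.2 = y.1.2.
  apply/val_inj; have /= := congr1 (divn^~ P) eqn.
  by rewrite !divnMDl ?(divn_small (small _)) ?addn0 // PE.
move: eqn; rewrite eqj => /addnI eqn.
have eqi : x.2 = y.2.
  apply/val_inj; have /= := congr1 (modn^~ H) eqn.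
  by rewrite ![(_ + co _ * H)%N]addnC !modnMDl !modn_small.
move: eqn; rewrite eqi => /addnI /eqP; rewrite eqn_mul2r (gtn_eqF H_gt0) /= => /eqP eqt.
have eqt' : x.1.1 = y.1.1.
  have le_e (t : 'I_e) : (t <= e.-1)%N by have := ltn_ord t; lia.
  by apply/val_inj; rewrite /= -(subKn (le_e x.1.1)) -/(co x) eqt /co subKn.
by case: x y eqi eqj eqt' {eqt} => [[? ?] ?] [[? ?] ?] /= -> -> ->.
Qed.

(** As [H * P.+1] is [(P * P - 1) / e], the last condition fixes the class of the value of [A / B]
    modulo [e]-th powers when that value lies in the field with [P * P] elements. All these points
    are roots of [Psi], so its degree bounds their number. *)
Lemma stepanov (ys : seq K) :
  uniq ys ->
  (forall y, y \in ys -> [/\ y ^+ (P * P) = y, A.[y] != 0, B.[y] != 0 &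
     A.[y] ^+ (H * P.+1) = zeta * B.[y] ^+ (H * P.+1)]) ->
  (e * size ys <= P * P + 3 * e * delta * P)%N.
Proof.
move=> Uys ysP; have [c [c0 rel]] := stepanov_relation.
have P0 : (0 < P)%N by rewrite PE.
(* With [P]-th roots as coefficients of [Psi], the power [Psi ^+ P] carries the coefficients [c] of
   the relation. *)
have [k kP] : exists k : I -> K, forall x, k x ^+ P = c x.
  apply: (@fin_all_exists _ (fun _ => K) (fun x z => z ^+ P = c x)) => x.
  have /closed_rootP [z] : size ('X^P - (c x)%:P) != 1 by rewrite size_XnsubC // PE.
  by rewrite /root !hornerE subr_eq0 => /eqP; exists z.
pose n x := (x.2 + x.1.2 * P + co x * H)%N.
pose Psi := \sum_x k x *: (('X - rho%:P) ^+ n x * (A ^+ (x.1.1 * H) * B1 ^+ (co x * H))).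
have Psi0 : Psi != 0.
  apply: combination_neq0; first exact: stepanov_order_inj.
    by move=> x; rewrite !hornerE mulf_neq0 ?expf_neq0.
  have [x cx] := c0; exists x; apply: contra_neq cx => kx0.
  by rewrite -kP kx0 expr0n gtn_eqF.
(* The form with [B1] shows the orders at [rho]; this one, with [co x * H] factors ['X - rho%:P]
   absorbed into [B], serves for the degree and the evaluation. *)
have PsiE : Psi = \sum_x k x *: (('X - rho%:P) ^+ (x.2 + x.1.2 * P) * (A ^+ (x.1.1 * H) * B ^+ (co x * H))).
  apply: eq_bigr => x _; congr (_ *: _); rewrite /n exprD BE exprMn; ring.
have sPsi : (size Psi <= (H.-1 + J.-1 * P + e.-1 * H * delta).+1)%N.
  rewrite PsiE; apply: leq_trans (size_sum _ _ _) _; apply/bigmax_leqP => -[[t j] i] _.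
  rewrite /co /=; apply: leq_trans (size_scale_leq _ _) _.
  have h1 := eq_leq (size_exp_XsubC (i + j * P) rho).
  have h3 := size_mul_leqS (size_exp_leqS (t * H) sA) (size_exp_leqS ((e.-1 - t) * H) sB).
  apply: leq_trans (size_mul_leqS h1 h3) _.
  rewrite ltnS -!mulnDl subnKC; last by have := ltn_ord t; lia.
  rewrite leq_add2r leq_add ?leq_mul2r //; first by have := ltn_ord i; lia.
  by apply/orP; right; have := ltn_ord j; lia.
have rPsi : all (root Psi) ys.
  apply/allP => y /ysP [yR Ay By AB].
  have pPP : [pchar K].-nat (P * P)%N by rewrite pnatM pcharP.
  have /eqP : Psi.[y] ^+ P * A.[y] ^+ (e.-1 * H) = 0.
    transitivity ((\sum_x c x *: (zeta ^+ x.1.1 *: (('X - rho%:P) ^+ (x.2 * P) *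
      ('X - (rho ^+ (P * P))%:P) ^+ x.1.2 *
      (B ^+ (x.1.1 * H) * A ^+ (co x * H))))).[y] * B.[y] ^+ (e.-1 * H * P)); last first.
      by rewrite rel horner0 mul0r.
    rewrite PsiE !horner_sum sum_expr_pchar // !big_distrl; apply: eq_bigr => x _ /=.
    rewrite !hornerE !exprMn kP -!exprM.
    (* The [P * P]-th power map fixes [y], which lowers the exponent [x.1.2 * P * P] to [x.1.2]. *)
    have -> : (y - rho) ^+ ((x.2 + x.1.2 * P) * P) =
              (y - rho) ^+ (x.2 * P) * (y - rho ^+ (P * P)) ^+ x.1.2.
      rewrite mulnDl exprD -mulnA [(x.1.2 * _)%N]mulnC [_ ^+ (P * P * _)]exprM.
      by rewrite (exprDn_pchar y (- rho) pPP) (exprNn_pchar rho pPP) yR.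
    have eE : e.-1 = (x.1.1 + co x)%N by rewrite subnKC //; have := ltn_ord x.1.1; lia.
    (* The total exponent is [x.1.1 * (H * P.+1) + co x * H]; the hypothesis on [zeta] trades the
       first part for a power of [B.[y]]. *)
    have EA : A.[y] ^+ (x.1.1 * H * P) * A.[y] ^+ (e.-1 * H) =
              zeta ^+ x.1.1 * B.[y] ^+ (H * P.+1 * x.1.1) * A.[y] ^+ (co x * H).
      rewrite [B.[y] ^+ _]exprM -exprMn -AB -exprM -!exprD; congr (_ ^+ _).
      by rewrite eE; ring.
    have EB : B.[y] ^+ (H * P.+1 * x.1.1) * B.[y] ^+ (co x * H * P) =
              B.[y] ^+ (x.1.1 * H) * B.[y] ^+ (e.-1 * H * P).
      by rewrite -!exprD; congr (_ ^+ _); rewrite eE; ring.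
    move: EA EB; move: (_ ^+ (x.1.1 * H * P)) (_ ^+ (e.-1 * H)) (_ ^+ (co x * H * P)).
    move: (_ ^+ (H * P.+1 * _)) (_ ^+ (co x * H)) (_ ^+ (x.1.1 * H)) (_ ^+ (_ * H * P)).
    move: (_ ^+ (x.2 * P)) (_ ^+ x.1.2) (_ ^+ x.1.1) (c x) => u v z d b1 a1 b2 b3 a2 a3 b4 EA EB.
    transitivity (d * (u * v) * (a2 * a3) * b4); first by ring.
    transitivity (d * z * u * v * b2 * a1 * b3); last by [].
    by rewrite EA; transitivity (d * (u * v) * z * a1 * (b1 * b4)); [ring | rewrite EB; ring].
  rewrite mulf_eq0 !expf_eq0 (negPf Ay) andbF orbF => /andP[_]; exact.
have := max_poly_roots Psi0 rPsi Uys.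
move/leq_trans => /(_ _ sPsi); rewrite ltnS => le.
rewrite (leq_trans (leq_mul (leqnn e) le)) //.
(* As [e * H < P], the product [e * J * P] is at most [P * P + 2 * e * delta * P]; the part
   [e * (e.-1 * H * delta)] adds at most [e * delta * P]. *)
rewrite /J PE; move: e_gt1 H_gt0; clear.
case: (e) => [|[|e']] //; case: (H) => [|H'] // _ _.
by rewrite /=; nia.
Qed.
End Stepanov.

(** * Extensions of a finite field inside an algebraic closure *)

Section Frobenius.
Variables (K : closedFieldType) (Q : nat) (Fr : {rmorphism K -> K}).
Hypotheses (FrE : forall x, Fr x = x ^+ Q) (Q_gt1 : (1 < Q)%N) (pcharQ : [pchar K].-nat Q).

(** The elements of the subfield of [K] with [Q ^ i] elements ([0 < i]). *)
Definition fixed_field i : seq K := sval (closed_field_poly_normal ('X^(Q ^ i) - 'X)).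

Lemma expQ_iter i x : x ^+ (Q ^ i) = iter i Fr x.
Proof. by elim: i => [|i IH]; rewrite ?expr1 // expnSr exprM IH iterS FrE. Qed.

Lemma expQ_inj i : injective (fun x : K => x ^+ (Q ^ i)).
Proof.
move=> x y; rewrite !expQ_iter; elim: i => //= i IH /fmorph_inj; exact: IH.
Qed.

Lemma size_XQi_subX i : (0 < i)%N -> size ('X^(Q ^ i) - 'X : {poly K}) = (Q ^ i).+1.
Proof.
move=> i0; rewrite size_polyDl size_polyXn // size_polyN size_polyX ltnS.
by rewrite (leq_trans Q_gt1) // -{1}(expn1 Q) leq_exp2l.
Qed.

Lemma fixed_field_prod i : (0 < i)%N -> 'X^(Q ^ i) - 'X = \prod_(y <- fixed_field i) ('X - y%:P).
Proof.
move=> i0; rewrite /fixed_field; case: closed_field_poly_normal => r /= {1}->.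
rewrite (_ : lead_coef _ = 1) ?scale1r //.
rewrite lead_coefDl ?lead_coefXn // size_polyN size_polyX size_polyXn ltnS.
by rewrite (leq_trans Q_gt1) // -{1}(expn1 Q) leq_exp2l.
Qed.

Lemma mem_fixed_field i y : (0 < i)%N -> (y \in fixed_field i) = (y ^+ (Q ^ i) == y).
Proof.
by move=> i0; rewrite -root_prod_XsubC -fixed_field_prod // /root !hornerE subr_eq0.
Qed.

Lemma uniq_fixed_field i : (0 < i)%N -> uniq (fixed_field i).
Proof.
move=> i0; rewrite -separable_prod_XsubC -fixed_field_prod // unlock.
rewrite derivB derivXn derivX (_ : 'X^_ *+ Q ^ i = 0) ?sub0r; last first.
  have [p pP pQ] : exists2 p, p \in [pchar K] & (p %| Q)%N.
    exists (pdiv Q); last exact: pdiv_dvd.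
    by apply: (pnatPpi pcharQ); rewrite pi_pdiv.
  apply/polyP => j; rewrite coefMn coef0.
  by apply/eqP; rewrite -mulr_natr mulf_eq0 -(dvdn_pcharf pP) dvdn_exp ?orbT.
by rewrite -(scaleN1r (1 : {poly K})) coprimepZr ?oppr_eq0 ?oner_eq0 // coprimep1.
Qed.

Lemma size_fixed_field i : (0 < i)%N -> size (fixed_field i) = (Q ^ i)%N.
Proof.
move=> i0; have := size_XQi_subX i0.
by rewrite fixed_field_prod // size_prod_XsubC => -[].
Qed.

(** Says that the coefficients lie in the field with [Q] elements, without making that field a
    type. *)
Definition fixpoly (h : {poly K}) := map_poly Fr h == h.

(** The monic polynomials of degree [j] over the field with [Q] elements. *)
Fixpoint fixed_monic (j : nat) : seq {poly K} :=
  if j is i.+1 then [seq h * 'X + c%:P | h <- fixed_monic i, c <- fixed_field 1] else [:: 1].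

Lemma fixpolyM g h : fixpoly g -> fixpoly h -> fixpoly (g * h).
Proof. by rewrite /fixpoly rmorphM /= => /eqP -> /eqP ->. Qed.

Lemma fixpolyMr g h : g != 0 -> fixpoly g -> fixpoly (g * h) -> fixpoly h.
Proof.
by rewrite /fixpoly rmorphM /= => g0 /eqP -> /eqP /(mulfI g0) ->.
Qed.

Lemma mem_fixed_monic j h : (h \in fixed_monic j) = [&& h \is monic, size h == j.+1 & fixpoly h].
Proof.
have MXsize (g : {poly K}) (c : K) : g \is monic ->
    size (g * 'X + c%:P) = (size g).+1 /\ g * 'X + c%:P \is monic.
  move=> mg; have sg : (size c%:P < size (g * 'X)%R)%N.
    by rewrite size_mulX ?monic_neq0 // (leq_ltn_trans (size_polyC_leq1 _)) // ltnS size_poly_gt0 monic_neq0.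
  split; first by rewrite size_polyDl // size_mulX ?monic_neq0.
  by rewrite monicE lead_coefDl // lead_coefMX -monicE.
elim: j h => [|j IH] h.
  rewrite inE; apply/eqP/and3P => [->|[mh /eqP/eqP/size_poly1P[c c0 hE] _]].
    by rewrite monic1 size_poly1 /fixpoly rmorph1 !eqxx.
  by move: mh; rewrite hE monicE lead_coefC => /eqP->.
apply/allpairsP/and3P => [[[g c] /= [gin cin ->]]|].
  move: gin; rewrite IH => /and3P [mg /eqP sg /eqP fg].
  have [-> ->] := MXsize g c mg; rewrite sg; split=> //.
  rewrite /fixpoly rmorphD rmorphM /= fg map_polyX map_polyC /= FrE.
  by move: cin; rewrite mem_fixed_field // expn1 => /eqP->.
elim/poly_ind: h => [|g c _] [mh sh fh]; first by rewrite size_poly0 in sh.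
have g0 : g != 0.
  by apply: contraTneq sh => ->; rewrite mul0r add0r size_polyC; case: (c == 0).
have sg : (size c%:P < size (g * 'X)%R)%N.
  by rewrite size_mulX // (leq_ltn_trans (size_polyC_leq1 _)) // ltnS size_poly_gt0.
have coE k : (map_poly Fr (g * 'X + c%:P))`_k = (g * 'X + c%:P)`_k by rewrite (eqP fh).
exists (g, c); rewrite /= IH mem_fixed_field // expn1; split=> //.
  move: mh sh; rewrite size_polyDl // size_mulX // eqSS => mh ->.
  rewrite monicE lead_coefDl // lead_coefMX -monicE in mh; rewrite mh /=.
  apply/eqP/polyP => k; move: (coE k.+1).
  by rewrite !coef_map !coefD !coefMX !coefC /= !addr0.
move: (coE 0%N); rewrite coef_map !coefD !coefMX !coefC /= !add0r.
by rewrite FrE => /eqP.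
Qed.

Lemma uniq_fixed_monic j : uniq (fixed_monic j).
Proof.
elim: j => // j IH; apply: allpairs_uniq => //; first exact: uniq_fixed_field.
move=> [g c] [g' c'] _ _ /= E.
have Ec : c = c'.
  by move/(congr1 (fun u : {poly K} => u`_0)): E; rewrite !coefD !coefMX !coefC /= !add0r.
by move: E; rewrite Ec => /addIr /(mulIf (negbT (polyX_eq0 _))) ->.
Qed.

(** Turns a sum over the multiples of [g] into a sum over their cofactors, as the Euler product
    argument requires. *)
Lemma fixed_monic_mul g i j : g \in fixed_monic i -> (i <= j)%N ->
  perm_eq [seq g * h | h <- fixed_monic (j - i)] [seq h <- fixed_monic j | g %| h].
Proof.
rewrite mem_fixed_monic => /and3P [mg /eqP sg fg] ij.
apply: uniq_perm.
- by rewrite map_inj_uniq ?uniq_fixed_monic //; apply: mulfI; apply: monic_neq0.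
- by rewrite filter_uniq ?uniq_fixed_monic.
move=> h; rewrite mem_filter mem_fixed_monic; apply/mapP/andP.
  case=> h'; rewrite mem_fixed_monic => /and3P [mh /eqP sh fh] ->.
  rewrite dvdp_mulr // monicMl // mh fixpolyM // size_monicM ?monic_neq0 // sg sh.
  by split=> //; rewrite andbT; apply/eqP; lia.
case=> /dvdpP [h' ->]; rewrite mulrC => /and3P [mh sh fh].
have h0 : h' != 0 by apply: contraTneq mh => ->; rewrite mulr0 monicE lead_coef0 eq_sym oner_eq0.
exists h'; rewrite // mem_fixed_monic (fixpolyMr (monic_neq0 mg) fg fh) -(monicMl h' mg) mh andbT /=.
move: sh; rewrite size_monicM // sg addSn /= => /eqP sh.
by rewrite -subSn // -sh addKn.
Qed.

(** For [y] in the field with [Q ^ i] elements, this is the characteristic polynomial of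
    [y] over the field with [Q] elements, that is a power of its minimal polynomial. *)
Definition orbit_poly i y : {poly K} := \prod_(j < i) ('X - (y ^+ (Q ^ j))%:P).

Lemma orbit_poly_monic i y : y ^+ (Q ^ i) = y -> orbit_poly i y \in fixed_monic i.
Proof.
move=> yi; rewrite mem_fixed_monic monic_prod_XsubC size_prod_XsubC.
rewrite /index_enum -enumT size_enum_ord eqxx /= /fixpoly /orbit_poly map_prod_XsubC.
case: i yi => [|i] yi; first by rewrite !big_ord0 eqxx.
rewrite big_ord_recr big_ord_recl /= mulrC; apply/eqP; congr (_ * _).
  by rewrite FrE -exprM -expnSr yi expr1.
by apply: eq_bigr => j _; rewrite FrE -exprM -expnSr.
Qed.

Lemma root_orbit_poly i y : (0 < i)%N -> root (orbit_poly i y) y.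
Proof.
by case: i => // i _; rewrite /orbit_poly big_ord_recl /= expr1 rootM root_XsubC eqxx.
Qed.

Lemma fixpoly_root h y i : fixpoly h -> root h y -> root h (y ^+ (Q ^ i)).
Proof.
move=> /eqP fh; elim: i => [|i IH] ry; first by rewrite expr1.
by rewrite expnSr exprM -FrE -fh /root horner_map fmorph_eq0; apply: IH.
Qed.

(** [d] is the degree of [y] over the field with [Q] elements. The conjugates of [y] are roots of
    [h], so two of them coincide, and injectivity of Frobenius yields a period. *)
Lemma periodP (h : {poly K}) y : h != 0 -> fixpoly h -> root h y ->
  exists2 d, (0 < d)%N & (forall i, (y ^+ (Q ^ i) == y) = (d %| i)%N).
Proof.
move=> h0 fh ry.
have ex : exists d, (0 < d)%N && (y ^+ (Q ^ d) == y).
  have : ~~ uniq [seq y ^+ (Q ^ i) | i <- iota 0 (size h)].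
    apply/negP => U; suff: (size h < size h)%N by rewrite ltnn.
    rewrite -{1}(size_iota 0 (size h)) -(size_map (fun i => y ^+ (Q ^ i))).
    apply: max_poly_roots => //; apply/allP => _ /mapP [i _ ->].
    exact: fixpoly_root.
  case/(uniqPn 0) => i [j [ij]]; rewrite size_map size_iota => jh.
  rewrite !(nth_map 0%N) ?size_iota ?(ltn_trans ij) // !nth_iota ?(ltn_trans ij) // !add0n => E.
  exists (j - i)%N; rewrite subn_gt0 ij; apply/eqP/(@expQ_inj i).
  by rewrite -exprM -expnD subnK // ltnW.
case: (ex_minnP ex) => d /andP [d0 /eqP yd] dmin; exists d => // i.
have per a : y ^+ (Q ^ (a * d)) = y.
  by elim: a => [|a IH]; rewrite ?expr1 // mulSn expnD exprM yd.
rewrite (divn_eq i d) expnD exprM per dvdn_addr ?dvdn_mull //.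
have [->|r0] := eqVneq (i %% d)%N 0%N; first by rewrite expr1 eqxx dvdn0.
rewrite gtnNdvd ?ltn_mod ?lt0n // -?lt0n //; apply/negbTE/negP => yr.
by have := dmin (i %% d)%N; rewrite lt0n r0 yr leqNgt ltn_mod d0 => /(_ isT).
Qed.

Lemma orbit_poly_expn d a y : y ^+ (Q ^ d) = y -> orbit_poly (a * d) y = orbit_poly d y ^+ a.
Proof.
move=> yd; elim: a => [|a IH]; first by rewrite /orbit_poly mul0n big_ord0.
rewrite exprS -IH mulSn /orbit_poly big_split_ord /=; congr (_ * _).
by apply: eq_bigr => j _; rewrite expnD exprM yd.
Qed.

Lemma uniq_orbit d (y : K) : (forall i, (y ^+ (Q ^ i) == y) = (d %| i)%N) ->
  uniq [seq y ^+ (Q ^ j) | j <- iota 0 d].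
Proof.
move=> per; rewrite map_inj_in_uniq ?iota_uniq // => i j; rewrite !mem_iota !add0n /=.
wlog ij : i j / (i <= j)%N => [W|] id jd E.
  by case/orP: (leq_total i j) => le; [|symmetry]; apply: W.
have : y ^+ (Q ^ (j - i)) == y.
  by apply/eqP/(@expQ_inj i); rewrite -exprM -expnD subnK.
rewrite per; have [|l0] := posnP (j - i)%N; first by lia.
by move/(dvdn_leq l0); lia.
Qed.

(** Here [orbit_poly d y] is the minimal polynomial of [y] and has [y] as a simple root, so
    splitting it off from [h] lowers the multiplicity of [y] by one. *)
Lemma orbit_poly_exp_dvd d y a h : (0 < d)%N -> (forall i, (y ^+ (Q ^ i) == y) = (d %| i)%N) ->
  h != 0 -> fixpoly h -> (orbit_poly d y ^+ a %| h) = (a <= mup y h)%N.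
Proof.
move=> d0 per; have yd : y ^+ (Q ^ d) = y by apply/eqP; rewrite per.
have := orbit_poly_monic yd; rewrite mem_fixed_monic => /and3P [mN sN fN].
pose s := [seq y ^+ (Q ^ j) | j <- iota 0 d].
have NE : orbit_poly d y = \prod_(z <- s) ('X - z%:P).
  by rewrite /orbit_poly /s big_map -(big_mkord xpredT (fun j => 'X - (y ^+ (Q ^ j))%:P)) /index_iota subn0.
have Us : uniq s by apply: uniq_orbit.
have y_s : y \in s by apply/mapP; exists 0%N; rewrite ?mem_iota ?expr1.
have muN : mup y (orbit_poly d y) = 1%N by rewrite NE mu_prod_XsubC count_uniq_mem ?y_s.
elim: a h => [|a IH] h h0 fh; first by rewrite dvd1p.
have [ry|nry] := boolP (root h y); last first.
  rewrite mupNroot // ltn0; apply/negbTE; apply: contra nry => /dvdpP [u ->].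
  by rewrite rootM exprS rootM root_orbit_poly ?orbT.
have /dvdpP [h' hE] : orbit_poly d y %| h.
  rewrite NE; apply: uniq_roots_dvdp; last by rewrite uniq_rootsE.
  by apply/allP => _ /mapP [i _ ->]; apply: fixpoly_root.
have h'0 : h' != 0 by apply: contraNneq h0 => h'0; rewrite hE h'0 mul0r.
have N0 := monic_neq0 mN.
have fh' : fixpoly h' by move: fh; rewrite hE mulrC; apply: fixpolyMr.
by rewrite hE mulrC exprS dvdp_mul2l // mupM // muN add1n ltnS IH.
Qed.

Lemma sum_nat_count (T : Type) (r : seq T) (b : pred T) :
  (\sum_(y <- r) b y)%N = count b r.
Proof. by rewrite -sum1_count [RHS]big_mkcond; apply: eq_bigr => y _; case: (b y). Qed.

(** A root [y] of degree [d] and multiplicity [m] is counted for [i.+1] equal to [d],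
    [2 * d] and so on up to [m * d]. *)
Lemma count_orbit_poly s h : h \in fixed_monic s ->
  (\sum_(i < s) \sum_(y <- fixed_field i.+1) (orbit_poly i.+1 y %| h)%R)%N = s.
Proof.
rewrite mem_fixed_monic => /and3P [mh /eqP sh fh]; have h0 := monic_neq0 mh.
have [rs hE] := closed_field_poly_normal h.
rewrite (monicP mh) scale1r in hE.
have srs : size rs = s by move: sh; rewrite hE size_prod_XsubC => -[].
have rE y : (y \in rs) = root h y by rewrite hE root_prod_XsubC.
have -> : (\sum_(i < s) \sum_(y <- fixed_field i.+1) (orbit_poly i.+1 y %| h)%R =
   \sum_(i < s) \sum_(y <- undup rs) (((y ^+ (Q ^ i.+1) == y) && (orbit_poly i.+1 y %| h))%R : bool))%N.
  apply: eq_bigr => i _; rewrite !sum_nat_count -!size_filter; apply: perm_size.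
  apply: uniq_perm; rewrite ?filter_uniq ?undup_uniq ?uniq_fixed_field // => y.
  rewrite !mem_filter mem_fixed_field // mem_undup rE andbC; apply/andP/andP => -[].
    move=> yi dv; rewrite yi dv; split=> //.
    by have /dvdpP [u ->] := dv; rewrite rootM root_orbit_poly ?orbT.
  by case/andP.
rewrite exchange_big /= -srs -[RHS]sum1_size -[RHS]big_undup_iterop_count.
apply: eq_big_seq => y; rewrite mem_undup rE => ry.
have [d d0 per] := periodP h0 fh ry.
have yd : y ^+ (Q ^ d) = y by apply/eqP; rewrite per.
have -> : iterop (count_mem y rs) addn 1%N 0%N = mup y h.
  by rewrite hE mu_prod_XsubC Monoid.iteropE iter_addn_0 mul1n.
(* This keeps all the multiples of [d] to be counted within the range [i < s]. *)
have le_s : (mup y h * d <= s)%N.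
  have : orbit_poly d y ^+ (mup y h) %| h by rewrite orbit_poly_exp_dvd.
  rewrite -orbit_poly_expn // => /dvdp_leq -/(_ h0).
  by rewrite size_prod_XsubC /index_enum -enumT size_enum_ord sh.
transitivity (\sum_(i < s) (d %| i.+1)%N && (i.+1 <= mup y h * d)%N)%N.
  rewrite srs; apply: eq_bigr => i _; rewrite per; case: dvdnP => //= -[a ->].
  by rewrite orbit_poly_expn // orbit_poly_exp_dvd // leq_pmul2r.
transitivity (\sum_(i < mup y h * d) (d %| i.+1)%N)%N.
  rewrite (big_ord_widen s (fun i => (d %| i.+1)%N : nat)) // [RHS]big_mkcond.
  by apply: eq_bigr => i _; rewrite andbC; case: ltnP.
by rewrite -[RHS](mulnK _ d0) divn_count_dvd big_add1 big_mkord.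
Qed.

Section Newton.
Variables (R : comNzRingType) (X : {poly K} -> R).
Hypothesis X_mul : forall i j g h, g \in fixed_monic i -> h \in fixed_monic j -> X (g * h) = X g * X h.

(** The logarithmic derivative of the Euler product of the L-function of [X]. *)
Lemma newton_fixed_monic s :
  (\sum_(h <- fixed_monic s) X h) *+ s =
  \sum_(i < s) (\sum_(y <- fixed_field i.+1) X (orbit_poly i.+1 y)) * \sum_(h <- fixed_monic (s - i.+1)) X h.
Proof.
(* By [count_orbit_poly] each [h] occurs [s] times; for fixed [i] and [y] the sum then runs over the
   multiples of one orbit polynomial. *)
transitivity (\sum_(h <- fixed_monic s) \sum_(i < s) \sum_(y <- fixed_field i.+1) (X h *+ (orbit_poly i.+1 y %| h)%R)).
  rewrite -sumrMnl; apply: eq_big_seq => h hs.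
  rewrite -{1}(count_orbit_poly hs) -sumrMnr; apply: eq_bigr => i _.
  by rewrite -sumrMnr.
rewrite exchange_big; apply: eq_bigr => i _ /=.
rewrite exchange_big big_distrl; apply: eq_big_seq => y yF /=.
have yi : y ^+ (Q ^ i.+1) = y by apply/eqP; rewrite -mem_fixed_field.
have Nm := orbit_poly_monic yi.
rewrite (eq_bigr (fun h => if orbit_poly i.+1 y %| h then X h else 0)); last first.
  by move=> h _; case: (_ %| _).
rewrite -big_mkcond -big_filter -(perm_big _ (fixed_monic_mul Nm (ltn_ord i))) big_map /=.
by rewrite big_distrr; apply: eq_big_seq => h hm; apply: X_mul Nm hm.
Qed.
End Newton.
End Frobenius.

(** * Weil's bound *)

Section Character.
Variables (K : fieldType) (N : nat) (g : K).
Hypothesis g_prim : N.-primitive_root g.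

(** For [om ^+ N = 1], the character of the group generated by [g] that sends [g] to [om], extended
    by 0; even for [om = 1] it vanishes at 0. *)
Definition chi (om : algC) (x : K) : algC :=
  if [pick i : 'I_N | x == g ^+ i] is Some i then om ^+ i else 0.

Section Fixed.
Variable om : algC.
Hypothesis omN : om ^+ N = 1.

Lemma chi_expg i : chi om (g ^+ i) = om ^+ i.
Proof.
rewrite /chi; case: pickP => [j|no].
  rewrite (eq_prim_root_expr g_prim) => /eqP /(congr1 (fun k => om ^+ k)).
  by rewrite !expr_mod.
have N0 := prim_order_gt0 g_prim.
by have := no (Ordinal (ltn_pmod i N0)); rewrite /= (prim_expr_mod g_prim) eqxx.
Qed.

Lemma chi0 : chi om 0 = 0.
Proof.
rewrite /chi; case: pickP => // j.
by rewrite eq_sym expf_eq0 (prim_root_eq0 g_prim) gtn_eqF ?andbF // (prim_order_gt0 g_prim).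
Qed.

Lemma chiM x y : (x == 0) || (x ^+ N == 1) -> (y == 0) || (y ^+ N == 1) ->
  chi om (x * y) = chi om x * chi om y.
Proof.
case/orP => [/eqP->|/eqP/(prim_rootP g_prim)[i ->]]; first by rewrite mul0r chi0 mul0r.
case/orP => [/eqP->|/eqP/(prim_rootP g_prim)[j ->]]; first by rewrite mulr0 chi0 mulr0.
by rewrite -exprD !chi_expg exprD.
Qed.
End Fixed.
End Character.

Section Weil.
Variables (K : closedFieldType) (Q : nat) (Fr : {rmorphism K -> K}).
Hypotheses (FrE : forall x, Fr x = x ^+ Q) (Q_gt1 : (1 < Q)%N) (pcharQ : [pchar K].-nat Q).
Variables (g : K) (om : algC) (e : nat).
Hypotheses (g_prim : (Q.-1).-primitive_root g) (e_dvd : (e %| Q.-1)%N).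
Hypotheses (om_e : om ^+ e = 1) (om_neq1 : om != 1).
Variables (rA rB : seq K) (w : nat) (c : K).
Hypotheses (w_gt0 : (0 < w)%N) (c_neq0 : c != 0) (cQ : c ^+ Q = c).
Hypotheses (rA_fix : perm_eq (map Fr rA) rA) (rB_fix : perm_eq (map Fr rB) rB).
Variables (M0 : {poly K}) (D : nat) (rho : K).
Hypotheses (M0_fix : fixpoly Fr M0) (sM0 : size M0 = D.+1).
Hypotheses (rA_M0 : {in rA, forall a, root M0 a}) (rB_M0 : {in rB, forall b, root M0 b}).
Hypotheses (rho_M0 : mup rho M0 = 1%N) (rho_rB : count_mem rho rB = 1%N) (rho_rA : rho \notin rA).

Local Notation chi := (chi Q.-1 g om).

Definition prod_values (r : seq K) (h : {poly K}) := \prod_(a <- r) h.[a].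
(** [Xval h] is the product of the values of [U] at the roots of [h], written through the
    zeros [rA] and the poles [rB] of [U], so that up to the power of [c] it depends only on
    [h] modulo [M0].  It is [0] when [h] has a root in [rA] or [rB], as [0^-1 = 0]. *)
Definition Xval (h : {poly K}) := c ^+ (size h).-1 * prod_values rA h ^+ w / prod_values rB h.
(** The factors are [a - y] rather than [y - a] since they are the values of ['X - y%:P] at the
    zeros and poles; signs go into [c]. *)
Definition Uval (y : K) := c * (\prod_(a <- rA) (a - y)) ^+ w / \prod_(b <- rB) (b - y).

Lemma om_expQ : om ^+ Q.-1 = 1.
Proof. by case/dvdnP: e_dvd => k ->; rewrite mulnC exprM om_e expr1n. Qed.

Lemma fixed_unit (x : K) : x ^+ Q = x -> (x == 0) || (x ^+ Q.-1 == 1).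
Proof.
have [//|x0 /=] := eqVneq x 0; rewrite -{1}(prednK (ltnW Q_gt1)) exprS => xQ.
by apply/eqP/(mulfI x0); rewrite xQ mulr1.
Qed.

Lemma prod_valuesM r h1 h2 : prod_values r (h1 * h2) = prod_values r h1 * prod_values r h2.
Proof. by rewrite /prod_values -big_split; apply: eq_bigr => a _; rewrite hornerM. Qed.

Lemma prod_values_fixed r h : perm_eq (map Fr r) r -> fixpoly Fr h -> prod_values r h ^+ Q = prod_values r h.
Proof.
move=> rf /eqP fh; rewrite -FrE rmorph_prod /= /prod_values.
rewrite -[RHS](perm_big _ rf) big_map; apply: eq_bigr => a _.
by rewrite -{2}fh horner_map.
Qed.

Lemma Xval_fixed h : fixpoly Fr h -> Xval h ^+ Q = Xval h.
Proof.
move=> fh; rewrite /Xval !exprMn exprVn (prod_values_fixed rB_fix fh) -!exprM.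
by rewrite mulnC exprM cQ [(w * _)%N]mulnC exprM (prod_values_fixed rA_fix fh).
Qed.

Lemma fixed_monic_fixpoly j h : h \in fixed_monic K Q j -> fixpoly Fr h.
Proof. by rewrite (mem_fixed_monic FrE) // => /and3P[]. Qed.

Lemma chiXM i j h1 h2 : h1 \in fixed_monic K Q i -> h2 \in fixed_monic K Q j ->
  chi (Xval (h1 * h2)) = chi (Xval h1) * chi (Xval h2).
Proof.
move=> m1 m2; rewrite -(chiM g_prim om_expQ); first last.
- by apply/fixed_unit/Xval_fixed/(fixed_monic_fixpoly m2).
- by apply/fixed_unit/Xval_fixed/(fixed_monic_fixpoly m1).
move: m1 m2; rewrite !(mem_fixed_monic FrE) // => /and3P [mo1 /eqP s1 _] /and3P [mo2 /eqP s2 _].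
congr chi; rewrite /Xval !prod_valuesM size_monicM ?monic_neq0 // s1 s2 addSn addnS /= exprD exprMn invfM.
by ring.
Qed.

Lemma UvalE y : Uval y = Xval ('X - y%:P).
Proof.
rewrite /Uval /Xval size_XsubC expr1 /prod_values; congr (_ * _ ^+ _ / _).
all: by apply: eq_bigr => a _; rewrite hornerXsubC.
Qed.

Lemma Uval_expQ y j : Uval (y ^+ (Q ^ j)) = Uval y ^+ (Q ^ j).
Proof.
have Ur r : perm_eq (map Fr r) r ->
   \prod_(a <- r) (a - y ^+ (Q ^ j)) = (\prod_(a <- r) (a - y)) ^+ (Q ^ j).
  move=> rf; elim: j => [|j IH]; first by rewrite !expr1.
  rewrite !expnSr !exprM -IH -[RHS]FrE rmorph_prod -[LHS](perm_big _ rf) big_map /=.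
  by apply: eq_bigr => a _; rewrite rmorphB /= !FrE.
rewrite /Uval !Ur // !exprMn exprVn -!exprM [(w * _)%N]mulnC; congr (_ * _ / _).
by elim: j {Ur} => [|j IH]; rewrite ?expr1 // expnSr exprM -IH cQ.
Qed.

(** The exponent is that of the norm from the field with [Q ^ i] elements to the field with [Q]
    elements: [Xval] multiplies the values of [U] over the conjugates. *)
Lemma Xval_orbit_poly i y : Xval (orbit_poly Q i y) = Uval y ^+ (\sum_(j < i) Q ^ j).
Proof.
rewrite expr_sum; under [RHS]eq_bigr do rewrite -Uval_expQ UvalE.
have ev r : prod_values r (orbit_poly Q i y) = \prod_(j < i) prod_values r ('X - (y ^+ (Q ^ j))%:P).
  rewrite /prod_values exchange_big; apply: eq_bigr => a _; exact: horner_prod.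
have sN : (size (orbit_poly Q i y)).-1 = i.
  by rewrite size_prod_XsubC /index_enum -enumT size_enum_ord.
have ci : c ^+ i = \prod_(j < i) c by rewrite prodr_const card_ord.
rewrite /Xval !ev sN ci -prodrXl -prodfV -!big_split /=.
by apply: eq_bigr => j _; rewrite size_XsubC expr1.
Qed.

Lemma count_mem_frobenius r a j : perm_eq (map Fr r) r ->
  count_mem (a ^+ (Q ^ j)) r = count_mem a r.
Proof.
move=> rf; elim: j => [|j IH]; first by rewrite expr1.
rewrite -IH expnSr exprM -FrE -(permP rf) count_map; apply: eq_count => x /=.
by rewrite (inj_eq (fmorph_inj Fr)).
Qed.

Lemma fixpoly_horner h x i : fixpoly Fr h -> h.[x ^+ (Q ^ i)] = h.[x] ^+ (Q ^ i).
Proof.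
move=> /eqP fh; elim: i => [|i IH]; first by rewrite !expr1.
by rewrite expnSr !exprM -IH -!FrE -{1}fh horner_map.
Qed.

Lemma fixpolyB (u v : {poly K}) : fixpoly Fr u -> fixpoly Fr v -> fixpoly Fr (u - v).
Proof. by rewrite /fixpoly rmorphB /= => /eqP -> /eqP ->. Qed.

Lemma size_fixed_monic j : size (fixed_monic K Q j) = (Q ^ j)%N.
Proof.
elim: j => //= j IH; rewrite size_allpairs IH size_fixed_field // expn1.
by rewrite expnSr.
Qed.

(** By counting: the [Q ^ d] monic polynomials of degree [d] take distinct values at [rho], since
    their differences have degree less than that of its minimal polynomial. *)
Lemma fixpoly_interp d z : (0 < d)%N -> (forall i, (rho ^+ (Q ^ i) == rho) = (d %| i)%N) ->
  z ^+ (Q ^ d) = z -> exists2 t, fixpoly Fr t & t.[rho] = z.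
Proof.
move=> d0 per zd.
have rd : rho ^+ (Q ^ d) = rho by apply/eqP; rewrite per.
pose vs := [seq t.[rho] | t <- fixed_monic K Q d].
have Uvs : uniq vs.
  rewrite map_inj_in_uniq ?uniq_fixed_monic //.
  move=> u v; rewrite !(mem_fixed_monic FrE) // => /and3P [mu /eqP su fu] /and3P [mv /eqP sv fv] uv.
  apply/eqP; rewrite -subr_eq0; apply/negPn/negP => uv0.
  have : (orbit_poly Q d rho ^+ 1 %| u - v).
    rewrite (orbit_poly_exp_dvd FrE) ?fixpolyB // -XsubC_dvd // dvdp_XsubCl.
    by rewrite /root !hornerE uv subrr.
  move/dvdp_leq => /(_ uv0); rewrite expr1 size_prod_XsubC /index_enum -enumT size_enum_ord.
  rewrite ltnNge => /negP; apply; apply/leq_sizeP => j; rewrite leq_eqVlt coefB.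
  case/orP => [/eqP <-|dj]; last by rewrite !nth_default ?subrr ?su ?sv.
  move: mu mv; rewrite !monicE !lead_coefE su sv => /eqP -> /eqP ->.
  by rewrite subrr.
have sub : {subset vs <= fixed_field K Q d}.
  move=> _ /mapP [t tm ->]; rewrite mem_fixed_field //.
  by rewrite -(fixpoly_horner _ _ (fixed_monic_fixpoly tm)) rd.
have [_ eqm] := uniq_min_size Uvs sub (eq_leq (etrans (size_fixed_field K Q_gt1 d0) (esym (etrans (size_map _ _) (size_fixed_monic d))))).
have : z \in vs by rewrite eqm mem_fixed_field // zd.
by case/mapP => t tm ->; exists t; rewrite // (fixed_monic_fixpoly tm).
Qed.

(** The character [h |-> chi (prod_values rA h ^+ w / prod_values rB h)] modulo [M0] is
    nontrivial because of the simple pole [rho]. *)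
Lemma unit_twist : exists u : {poly K}, [/\ fixpoly Fr u, coprimep u M0,
  prod_values rA u = 1 & prod_values rB u = g].
Proof.
have M00 : M0 != 0 by rewrite -size_poly_eq0 sM0.
have rho_root : root M0 rho by rewrite -dvdp_XsubCl XsubC_dvd // rho_M0.
have [d d0 per] := periodP FrE M00 M0_fix rho_root.
have rd : rho ^+ (Q ^ d) = rho by apply/eqP; rewrite per.
set P := orbit_poly Q d rho.
have Pm : P \in fixed_monic K Q d by exact: (orbit_poly_monic FrE).
have P0 : P != 0 by move: Pm; rewrite (mem_fixed_monic FrE) // => /and3P [/monic_neq0].
have [M1 M0E] : exists M1, M0 = P * M1.
  have : P ^+ 1 %| M0 by rewrite (orbit_poly_exp_dvd FrE) ?rho_M0.
  by rewrite expr1 => /dvdpP [M1 ->]; exists M1; rewrite mulrC.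
have M1f : fixpoly Fr M1 by move: M0_fix; rewrite M0E; apply: fixpolyMr (fixed_monic_fixpoly Pm).
have M10 : M1 != 0 by apply: contraNneq M00 => M10; rewrite M0E M10 mulr0.
have M1rho : M1.[rho] != 0.
  apply/negP => /= r1; have := rho_M0; rewrite M0E mupM //.
  have : (0 < mup rho M1)%N by rewrite -XsubC_dvd // dvdp_XsubCl.
  have : (0 < mup rho P)%N by rewrite -XsubC_dvd // dvdp_XsubCl root_orbit_poly.
  by case: (mup rho P) (mup rho M1) => [|m1] [|m2] //; rewrite addnS.
(* [T] is the norm exponent; a [T]-th root [y] of [g] lies in the field with [Q ^ d] elements
   because [g ^+ Q.-1 = 1]. *)
pose T := (\sum_(j < d) Q ^ j)%N.
have TQ : (Q.-1 * T = (Q ^ d).-1)%N by rewrite predn_exp.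
have T0 : (0 < T)%N by rewrite /T -(prednK d0) big_ord_recl.
have [y yT] : exists y, y ^+ T = g.
  have /closed_rootP [z] : size ('X^T - g%:P) != 1 by rewrite size_XnsubC // eqSS -lt0n.
  by rewrite /root !hornerE subr_eq0 => /eqP; exists z.
have yd : y ^+ (Q ^ d) = y.
  rewrite -[(Q ^ d)%N]prednK ?expn_gt0 ?(ltnW Q_gt1) // exprS -TQ mulnC exprM yT.
  by rewrite (prim_expr_order g_prim) mulr1.
(* Chinese remaindering made explicit: [1 + M1 * t] is [y] at [rho] and 1 at the roots of [M1]. *)
have [t tf tE] : exists2 t, fixpoly Fr t & t.[rho] = (y - 1) / M1.[rho].
  apply: (fixpoly_interp d0 per).
  have pQd : [pchar K].-nat (Q ^ d)%N by rewrite pnatX pcharQ.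
  rewrite exprMn exprVn -(fixpoly_horner _ _ M1f) rd; congr (_ / _).
  by rewrite (exprDn_pchar y (-1) pQd) (exprNn_pchar 1 pQd) expr1n yd.
pose u := 1 + M1 * t; pose orb := [seq rho ^+ (Q ^ j) | j <- iota 0 d].
have uf : fixpoly Fr u.
  by rewrite /fixpoly /u rmorphD rmorph1 /= (eqP (fixpolyM M1f tf)).
have urho j : u.[rho ^+ (Q ^ j)] = y ^+ (Q ^ j).
  rewrite fixpoly_horner // /u !hornerE tE; congr (_ ^+ _).
  by rewrite mulrCA mulfV // mulr1 addrC subrK.
have PE : P = \prod_(z <- orb) ('X - z%:P).
  by rewrite /P /orbit_poly /orb big_map -(big_mkord xpredT (fun j => 'X - (rho ^+ (Q ^ j))%:P)) /index_iota subn0.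
have Porb x : root P x = (x \in orb) by rewrite PE root_prod_XsubC.
have u1 x : root M0 x -> x \notin orb -> u.[x] = 1.
  rewrite M0E rootM Porb => /orP [->//|/rootP M1x _].
  by rewrite /u !hornerE M1x mul0r addr0.
have Uorb : uniq orb by apply: (uniq_orbit FrE).
have g0 : g != 0 by rewrite (prim_root_eq0 g_prim) -lt0n -ltnS prednK // ltnW.
have y0 : y != 0 by apply: contra_neq g0 => y0; rewrite -yT y0 expr0n gtn_eqF.
exists u; split=> //.
- rewrite coprimep_sym; apply: Pdiv.ClosedField.root_coprimep => x xM0.
  have [|xorb] := boolP (x \in orb); last by rewrite u1 ?oner_eq0.
  by case/mapP => j _ ->; rewrite urho expf_neq0.
- rewrite /prod_values big_seq big1 // => a aA; rewrite u1 ?rA_M0 //.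
  apply: contra rho_rA => /mapP [j _ aE].
  by rewrite -has_pred1 has_count -(count_mem_frobenius rho j rA_fix) -has_count has_pred1 -aE.
rewrite /prod_values (bigID (mem orb)) /= [X in _ * X]big_seq_cond [X in _ * X]big1 ?mulr1; last first.
  by move=> b /andP [bB borb]; rewrite u1 ?rB_M0.
rewrite -big_filter (perm_big orb).
  rewrite /orb big_map -yT expr_sum.
  rewrite -(big_mkord xpredT (fun j => y ^+ (Q ^ j))) /index_iota subn0.
  by apply: eq_bigr => j _; rewrite urho.
(* Each conjugate of [rho] occurs in [rB] exactly once, so the product over these poles is the norm
   of [y], that is [g]. *)
have cnt x : count_mem x [seq b <- rB | b \in orb] = (x \in [seq b <- rB | b \in orb]).
  rewrite count_filter mem_filter; have [xo|xo] := boolP (x \in orb); last first.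
    by apply/eqP; rewrite -leqn0 leqNgt -has_count; apply/hasP => -[z _ /= /andP [/eqP ->]]; apply/negP.
  rewrite (eq_count (a2 := pred1 x)); last first.
    by move=> z /=; case: eqP => // ->; rewrite xo.
  case/mapP: xo => j _ ->; rewrite count_mem_frobenius // rho_rB /=.
  by rewrite -has_pred1 has_count count_mem_frobenius // rho_rB.
apply: uniq_perm => //; first exact: count_mem_uniq.
move=> x; rewrite mem_filter andb_idr // => /mapP [j _ ->].
by rewrite -has_pred1 has_count count_mem_frobenius // rho_rB.
Qed.

(** [h |-> h + (u - 1) * h %% M0] permutes the monic polynomials of degree [j] and
    multiplies the character modulo [M0] by its nontrivial value at [u]. *)
Lemma sum_fixed_monic_eq0 j : (D <= j)%N -> \sum_(h <- fixed_monic K Q j) chi (Xval h) = 0.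
Proof.
move=> Dj; have [u [uf cop uA uB]] := unit_twist.
have M00 : M0 != 0 by rewrite -size_poly_eq0 sM0.
have g0 : g != 0 by rewrite (prim_root_eq0 g_prim) -lt0n -ltnS prednK // ltnW.
pose phi (h : {poly K}) := h + ((u - 1) * h) %% M0.
have u1f : fixpoly Fr (u - 1) by rewrite fixpolyB // /fixpoly rmorph1.
have phi_val h a : root M0 a -> (phi h).[a] = u.[a] * h.[a].
  move/rootP => M0a; rewrite /phi hornerD.
  have := congr1 (horner^~ a) (divp_eq ((u - 1) * h) M0).
  rewrite !hornerE M0a mulr0 add0r => <-; ring.
have phi_mon h : h \in fixed_monic K Q j -> phi h \in fixed_monic K Q j.
  rewrite !(mem_fixed_monic FrE) // => /and3P [mh /eqP sh fh].
  (* The remainder has degree below [D <= j], so adding it keeps [h] monic of degree [j]. *)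
  have lt : (size ((u - 1) * h %% M0)%R < size h)%N.
    by rewrite sh ltnS (leq_trans _ Dj) // -ltnS -sM0 ltn_modp.
  rewrite monicE lead_coefDl // -monicE mh size_polyDl // sh eqxx /=.
  by rewrite /fixpoly /phi rmorphD /= map_modp (eqP (fixpolyM u1f fh)) (eqP fh) (eqP M0_fix).
have phi_inj : injective phi.
  move=> h h' E; have rr : (u - 1) * h %% M0 - (u - 1) * h' %% M0 = (u - 1) * (h - h') %% M0.
    by rewrite mulrBr modpD modpN.
  have E' : (h - h') + (u - 1) * (h - h') %% M0 = 0.
    by rewrite -rr addrACA -opprD -/(phi h) -/(phi h') E subrr.
  have dv : M0 %| h - h'.
    rewrite -(Gauss_dvdpr _ (q := u)) 1?coprimep_sym // /dvdp.
    rewrite -[u in u * _](subrK 1 u) mulrDl mul1r addrC modpD.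
    by rewrite -[X in _ + X]modp_id -modpD E' mod0p.
  apply/eqP; rewrite -subr_eq0 -E' -[X in X == _]addr0 (inj_eq (addrI _)) eq_sym.
  by apply: dvdp_mull.
have Xphi h : h \in fixed_monic K Q j -> chi (Xval (phi h)) = chi g^-1 * chi (Xval h).
  move=> hm; have ev r : {in r, forall a, root M0 a} -> prod_values r (phi h) = prod_values r u * prod_values r h.
    by move=> rM0; rewrite /prod_values -big_split; apply: eq_big_seq => a /rM0 /phi_val.
  have -> : Xval (phi h) = g^-1 * Xval h.
    move: (phi_mon h hm) (hm); rewrite !(mem_fixed_monic FrE) // => /and3P [_ /eqP s1 _] /and3P [_ /eqP s2 _].
    by rewrite /Xval s1 s2 !ev // uA uB mul1r invfM; ring.
  rewrite (chiM g_prim om_expQ) //; last exact/fixed_unit/Xval_fixed/(fixed_monic_fixpoly hm).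
  by rewrite exprVn (prim_expr_order g_prim) invr1 eqxx orbT.
have chig : chi g^-1 * om = 1.
  have chig1 : chi g = om by rewrite -[g in chi g]expr1 (chi_expg g_prim om_expQ).
  rewrite -[X in _ * X]chig1 -(chiM g_prim om_expQ); first last.
  - by rewrite (prim_expr_order g_prim) eqxx orbT.
  - by rewrite exprVn (prim_expr_order g_prim) invr1 eqxx orbT.
  by rewrite mulVf // -(expr0 g) (chi_expg g_prim om_expQ).
have pe : perm_eq [seq phi h | h <- fixed_monic K Q j] (fixed_monic K Q j).
  have U : uniq [seq phi h | h <- fixed_monic K Q j] by rewrite map_inj_uniq ?uniq_fixed_monic.
  apply: uniq_perm; rewrite ?uniq_fixed_monic //.
  have sub : {subset [seq phi h | h <- fixed_monic K Q j] <= fixed_monic K Q j}.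
    by move=> _ /mapP [h hm ->]; apply: phi_mon.
  by have [] := uniq_min_size U sub; rewrite ?size_map.
set S := \sum_(h <- _) _.
have SE : S = chi g^-1 * S.
  rewrite {1}/S -(perm_big _ pe) big_map big_distrr /=.
  exact: eq_big_seq.
have : S * (om - 1) = 0.
  by rewrite mulrBr mulr1 {1}SE mulrAC chig mul1r subrr.
by move/eqP; rewrite mulf_eq0 subr_eq0 (negPf om_neq1) orbF => /eqP.
Qed.
(** The sums over monic polynomials of degree [j] are the coefficients of the L-function; they
    vanish from [D] on, and [newton_fixed_monic] is the recursion. *)
Lemma L_power_sums : exists2 rs : seq algC, (size rs < D)%N &
  forall s, \sum_(y <- fixed_field K Q s.+1) chi (Xval (orbit_poly Q s.+1 y)) = - \sum_(x <- rs) x ^+ s.+1.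
Proof.
apply: (@recursion_power_sums (fun j => \sum_(h <- fixed_monic K Q j) chi (Xval h))
  (fun s => \sum_(y <- fixed_field K Q s) chi (Xval (orbit_poly Q s y)))).
- have M00 : M0 != 0 by rewrite -size_poly_eq0 sM0.
  have : size M0 != 1%N.
    by apply/closed_rootP; exists rho; rewrite -dvdp_XsubCl XsubC_dvd // rho_M0.
  by rewrite sM0 eqSS lt0n.
- rewrite /= big_seq1 /Xval size_poly1 /prod_values !big1 ?expr1n ?divr1 ?mulr1 => [|a _|a _].
  + by rewrite (chi_expg g_prim om_expQ 0).
  + by rewrite hornerC.
  + by rewrite hornerC.
- exact: sum_fixed_monic_eq0.
- move=> s; exact: (newton_fixed_monic FrE Q_gt1 pcharQ chiXM).
Qed.

Definition Upol_num : {poly K} := c *: (\prod_(a <- rA) (a%:P - 'X)) ^+ w.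
Definition Upol_den : {poly K} := \prod_(b <- rB) (b%:P - 'X).

Lemma Uval_num_den y : Uval y = Upol_num.[y] / Upol_den.[y].
Proof.
rewrite /Uval /Upol_num /Upol_den hornerZ horner_exp !horner_prod.
by congr (_ * _ ^+ _ / _); apply: eq_bigr => a _; rewrite !hornerE.
Qed.

Lemma size_prod_subX (r : seq K) : (size (\prod_(a <- r) (a%:P - 'X))%R <= (size r).+1)%N.
Proof.
elim: r => [|a r IH]; first by rewrite big_nil size_poly1.
rewrite big_cons; apply: (size_mul_leqS (a := 1) _ IH).
by rewrite -opprB size_polyN size_XsubC.
Qed.

Lemma prod_sub_eq0 (r : seq K) y : (\prod_(a <- r) (a - y) == 0) = (y \in r).
Proof.
rewrite prodf_seq_eq0; apply/hasP/idP => [[a ar /=]|yr].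
  by rewrite subr_eq0 => /eqP <-.
by exists y; rewrite //= subrr.
Qed.

Lemma Uval_eq0 y : (Uval y == 0) = (y \in rA) || (y \in rB).
Proof.
by rewrite /Uval !mulf_eq0 invr_eq0 (negPf c_neq0) expf_eq0 w_gt0 !prod_sub_eq0.
Qed.

(** [stepanov] bounds each of the [e] classes [cls r] from above. Lower bounds are unnecessary: as
    the powers of [om] sum to 0, only the deficits [m r] from the common bound matter, and their
    total is small because the classes nearly fill the field. *)
Lemma stepanov_sum : exists C : algC, forall s,
  `|\sum_(y <- fixed_field K Q (2 * s.+1)) chi (Xval (orbit_poly Q (2 * s.+1) y))| <= C * Q%:R ^+ s.+1.
Proof.
pose delta := (w * size rA + size rB)%N.
pose E := (size rA + size rB)%N.
have e0 : (0 < e)%N by apply: dvdn_gt0 e_dvd; rewrite -ltnS prednK // ltnW.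
have e1 : (1 < e)%N.
  by rewrite ltn_neqAle e0 andbT; apply: contra_neq om_neq1 => e1; rewrite -om_e -e1.
(* [E] accounts for the zeros and poles of [U], which belong to no class. *)
exists (3 * e * delta + E)%:R => s; set s1 := s.+1; pose P := (Q ^ s1)%N.
have pcharP : [pchar K].-nat P by rewrite pnatX pcharQ.
have eP : (e %| P.-1)%N by rewrite predn_exp dvdn_mulr.
pose H := (P.-1 %/ e)%N.
have P_gt1 : (1 < P)%N by rewrite -{1}(exp1n s1) ltn_exp2r.
have PE : P = (e * H).+1 by rewrite /H mulnC divnK // prednK // ltnW.
have H0 : (0 < H)%N by rewrite divn_gt0 // dvdn_leq // -ltnS prednK // ltnW.
pose z := g ^+ (Q.-1 %/ e).
have z_prim : e.-primitive_root z.
  by have := dvdn_prim_root g_prim e_dvd.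
pose Ys := fixed_field K Q (2 * s1).
have R2 : (Q ^ (2 * s1) = P * P)%N by rewrite mulnC expnM mulnn.
pose cls r := [seq y <- Ys | (Uval y != 0) && (Uval y ^+ (H * P.+1) == z ^+ r)].
have Yfix y : y \in Ys -> y ^+ (P * P) = y by rewrite mem_fixed_field // R2 => /eqP.
have cls_bound r : (e * size (cls r) <= P * P + 3 * e * delta * P)%N.
  have [B1 BE B1rho] : exists2 B1, Upol_den = ('X - rho%:P) * B1 & B1.[rho] != 0.
    have rB_rho : rho \in rB by rewrite -has_pred1 has_count rho_rB.
    exists (- \prod_(b <- rem rho rB) (b%:P - 'X)).
      by rewrite /Upol_den (perm_big _ (perm_to_rem rB_rho)) big_cons mulrN -mulNr opprB.
    rewrite hornerN oppr_eq0 horner_prod.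
    rewrite (eq_bigr (fun b => b - rho)) => [|b _]; last by rewrite !hornerE.
    by rewrite prod_sub_eq0 -has_pred1 has_count count_rem rho_rB rB_rho /= eqxx.
  apply: (@stepanov K P e H delta Upol_num Upol_den B1 rho (z ^+ r)) => //.
  - apply: leq_trans (size_scale_leq _ _) _.
    by apply: leq_trans (size_exp_leqS w (size_prod_subX rA)) _; rewrite ltnS leq_addr.
  - by apply: leq_trans (size_prod_subX rB) _; rewrite ltnS leq_addl.
  - rewrite hornerZ horner_exp horner_prod mulf_neq0 ?expf_neq0 //.
    rewrite (eq_bigr (fun b => b - rho)) => [|b _]; last by rewrite !hornerE.
    by rewrite prod_sub_eq0.
  - by rewrite filter_uniq // uniq_fixed_field.
  move=> y; rewrite mem_filter => /andP [/andP [Uy /eqP Uz] /Yfix yf].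
  move: (Uy) Uz; rewrite Uval_num_den mulf_eq0 invr_eq0 negb_or => /andP [Ay By].
  by rewrite expr_div_n => <-; split=> //; rewrite divfK // expf_neq0.
pose T := (\sum_(j < 2 * s1) Q ^ j)%N.
have TQ : (Q.-1 * T = e * (H * P.+1))%N.
  by rewrite -predn_exp R2 mulnA PE mulSn addSn /= -mulnS.
have T0 : (0 < T)%N by rewrite /T mulnS big_ord_recl.
have cls_chi y : y \in Ys -> Uval y != 0 ->
    exists2 r : 'I_e, Uval y ^+ (H * P.+1) = z ^+ r & chi (Xval (orbit_poly Q (2 * s1) y)) = om ^+ r.
  move=> yYs Uy; have yR : y ^+ (Q ^ (2 * s1)) = y by rewrite R2 Yfix.
  have := fixed_unit (Xval_fixed (fixed_monic_fixpoly (orbit_poly_monic FrE Q_gt1 yR))).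
  rewrite Xval_orbit_poly -/T expf_eq0 T0 (negPf Uy) /= => /eqP /(prim_rootP g_prim) [i Ui].
  exists (Ordinal (ltn_pmod i e0)); last by rewrite Ui (chi_expg g_prim om_expQ) /= expr_mod.
  (* So the class of [Uval y] is read off from its norm, the power of exponent [T]. *)
  have -> : (H * P.+1 = T * (Q.-1 %/ e))%N.
    by apply/eqP; rewrite -(eqn_pmul2l e0) -TQ mulnCA [(e * _)%N]mulnC divnK // mulnC.
  by rewrite exprM Ui -exprM mulnC exprM /= (prim_expr_mod z_prim).
have z_inj (r r' : 'I_e) : (z ^+ r == z ^+ r') = (r == r').
  by rewrite (eq_prim_root_expr z_prim) !modn_small.
have sumE : \sum_(y <- Ys) chi (Xval (orbit_poly Q (2 * s1) y)) =
    \sum_(r < e) (size (cls r))%:R * om ^+ r.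
  transitivity (\sum_(r < e) \sum_(y <- Ys)
     ((Uval y != 0) && (Uval y ^+ (H * P.+1) == z ^+ r))%:R * om ^+ r); last first.
    by apply: eq_bigr => r _; rewrite size_filter -sum_nat_count natr_sum big_distrl.
  rewrite exchange_big; apply: eq_big_seq => y yYs /=.
  have [Uy|Uy] := eqVneq (Uval y) 0.
    rewrite Xval_orbit_poly -/T Uy expr0n gtn_eqF // (chi0 g_prim) big1 // => r _.
    by rewrite mul0r.
  have [r0 Ur ->] := cls_chi y yYs Uy.
  rewrite (bigD1 r0) //= Ur eqxx mul1r big1 ?addr0 // => r rr0.
  by rewrite z_inj eq_sym (negPf rr0) mul0r.
have sum_size : (P * P <= \sum_(r < e) size (cls r) + E)%N.
  have -> : (\sum_(r < e) size (cls r) = count (fun y => (Uval y != 0)%R) Ys)%N.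
    transitivity (\sum_(r < e) \sum_(y <- Ys)
       ((Uval y != 0)%R && (Uval y ^+ (H * P.+1) == z ^+ r)%R))%N.
      by apply: eq_bigr => r _; rewrite size_filter -sum_nat_count.
    rewrite exchange_big -sum_nat_count; apply: eq_big_seq => y yYs /=.
    have [Uy|Uy] := eqVneq (Uval y) 0; first by rewrite big1.
    have [r0 Ur _] := cls_chi y yYs Uy.
    by rewrite (bigD1 r0) //= Ur eqxx big1 // => r rr0; rewrite z_inj eq_sym (negPf rr0).
  rewrite -R2 -(size_fixed_field K Q_gt1 (i := 2 * s1)) // -/Ys -(count_predC (fun y => (Uval y != 0)%R)) leq_add2l.
  rewrite -size_filter /E -size_cat; apply: uniq_leq_size.
    by rewrite filter_uniq // uniq_fixed_field.
  by move=> y; rewrite mem_filter /= negbK Uval_eq0 mem_cat => /andP [].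
have sum_om : \sum_(r < e) om ^+ r = 0.
  have : (om - 1) * \sum_(r < e) om ^+ r = 0 by rewrite -subrX1 om_e subrr.
  by move/eqP; rewrite mulf_eq0 subr_eq0 (negPf om_neq1) => /eqP.
have om_norm r : `|om ^+ r| = 1.
  have : `|om| ^+ e = 1 by rewrite -normrX om_e normr1.
  by move/eqP; rewrite pexpr_eq1 // => /eqP; rewrite normrX => ->; rewrite expr1n.
pose m r := (P * P + 3 * e * delta * P - e * size (cls r))%N.
rewrite sumE -(ler_pM2l (x := e%:R)) ?ltr0n // -[X in X * `|_|]normr_nat -normrM.
have -> : e%:R * (\sum_(r < e) (size (cls r))%:R * om ^+ r) = - \sum_(r < e) (m r)%:R * om ^+ r.
  apply/eqP; rewrite -addr_eq0 big_distrr -big_split /=.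
  rewrite (eq_bigr (fun r : 'I_e => (P * P + 3 * e * delta * P)%:R * om ^+ r)).
    by rewrite -big_distrr /= sum_om mulr0.
  by move=> r _; rewrite mulrA -natrM -mulrDl -natrD subnKC.
rewrite normrN (le_trans (ler_norm_sum _ _ _)) //.
rewrite (eq_bigr (fun r : 'I_e => (m r)%:R)) => [|r _]; last first.
  by rewrite normrM om_norm mulr1 normr_nat.
rewrite -natr_sum -natrX -!natrM ler_nat -/P.
have : (\sum_(r < e) m r + e * \sum_(r < e) size (cls r) = e * (P * P + 3 * e * delta * P))%N.
  rewrite big_distrr -big_split /=.
  rewrite (eq_bigr (fun=> P * P + 3 * e * delta * P)%N) => [|r _].
    by rewrite sum_nat_const card_ord.
  by rewrite subnK.
have := leq_mul (leqnn e) sum_size.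
move: (\sum_(r < e) _)%N (\sum_(r < e) _)%N; clear - e0 P_gt1.
move: delta E P P_gt1 => dl E' P P1 a b h1 h2.
have : (e * E' <= e * E' * P)%N by rewrite leq_pmulr // ltnW.
lia.
Qed.

(** Even extensions see only the squares of the inverse roots, so [power_sum_bound] is applied to
    these squares with bound [Q]. *)
Theorem weil_bound :
  `|\sum_(y <- fixed_field K Q 1) chi (Uval y)| <= D.-1%:R * sqrtC Q%:R.
Proof.
have [rs srs rsE] := L_power_sums; have [C Cb] := stepanov_sum.
have bnd x : x \in rs -> `|x| <= sqrtC Q%:R.
  move=> xrs; have : x ^+ 2 \in [seq x ^+ 2 | x <- rs] by exact: (map_f (fun x => x ^+ 2)).
  move/(power_sum_bound (B := Q%:R) (C := C)) => h.
  rewrite -(ler_pXn2r (n := 2)) ?nnegrE ?sqrtC_ge0 ?ler0n // sqrtCK -normrX.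
  apply: h; rewrite ?ler0n // => s.
  rewrite big_map; under eq_bigr do rewrite -exprM.
  by have := Cb s; rewrite mulnS rsE normrN.
have -> : \sum_(y <- fixed_field K Q 1) chi (Uval y) = - \sum_(x <- rs) x.
  have := rsE 0%N; under [in X in _ = X]eq_bigr do rewrite expr1.
  by move=> <-; apply: eq_bigr => y _; rewrite Xval_orbit_poly big_ord1 expr1.
rewrite normrN (le_trans (ler_norm_sum _ _ _)) //.
apply: (@le_trans _ _ ((size rs)%:R * sqrtC Q%:R)); last first.
  by rewrite ler_wpM2r ?sqrtC_ge0 ?ler0n // ler_nat -ltnS (ltn_predK srs).
rewrite -sum1_size natr_sum big_distrl /= big_seq [leRHS]big_seq.
by apply: ler_sum => x xrs; rewrite mul1r bnd.
Qed.
End Weil.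

(** * Power values of rational functions *)

Section FrobeniusPower.
Variables (R : comNzRingType) (Q : nat) (pcharQ : [pchar R].-nat Q).

(** The hypothesis on [Q] is an argument so that the ring morphism structure can be attached to the
    function. *)
Definition frobenius_expn of [pchar R].-nat Q := fun x : R => x ^+ Q.

Fact frobenius_expn_additive : zmod_morphism (frobenius_expn pcharQ).
Proof. by move=> x y; rewrite /frobenius_expn exprDn_pchar // exprNn_pchar. Qed.

Fact frobenius_expn_multiplicative : monoid_morphism (frobenius_expn pcharQ).
Proof. by split=> [|x y]; rewrite /frobenius_expn ?expr1n ?exprMn. Qed.

HB.instance Definition _ := GRing.isZmodMorphism.Build R R
  (frobenius_expn pcharQ) frobenius_expn_additive.
HB.instance Definition _ := GRing.isMonoidMorphism.Build R R
  (frobenius_expn pcharQ) frobenius_expn_multiplicative.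
End FrobeniusPower.

Section PowerValue.
Variables (F : finFieldType) (K : closedFieldType) (iota : {rmorphism F -> K}).
Variables (kap w : nat) (A B M0 : {poly F}) (D : nat) (rho : K).
Hypothesis pcharF : [pchar F].-nat #|F|.
Hypotheses (kap_gt0 : (0 < kap)%N) (w_gt0 : (0 < w)%N).
Hypotheses (sM0 : size M0 = D.+1) (A_M0 : A %| M0) (B_M0 : B %| M0).
Hypotheses (rho_M0 : mup rho (map_poly iota M0) = 1%N).
Hypotheses (rho_B : root (map_poly iota B) rho) (rho_A : ~~ root (map_poly iota A) rho).
Let Q := #|F|.
Let e := gcdn kap Q.-1.
Hypothesis bound : ((e.+1 * D.+1) ^ 2 <= Q)%N.

(** Without a solution, the sum over [a < e] of the characters at [U y] vanishes whenever [M0.[y] !=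
    0]. The trivial character then contributes about [Q] in all, which the others, bounded by Weil,
    cannot cancel. *)
Lemma power_value : exists y x : F, [/\ M0.[y] != 0, x != 0 & x ^+ kap = A.[y] ^+ w / B.[y]].
Proof.
have Q_gt1 : (1 < Q)%N by exact: finNzRing_gt1.
have pcharQ : [pchar K].-nat Q by rewrite (eq_pnat _ (fmorph_pchar iota)).
have [Fr FrE] : exists Fr : {rmorphism K -> K}, forall x, Fr x = x ^+ Q.
  by exists (frobenius_expn pcharQ).
have iotaQ x : iota x ^+ Q = iota x by rewrite -rmorphXn expf_card.
pose emb := [seq iota x | x <- enum F].
have mem_emb y : (y \in emb) = (y ^+ Q == y).
  have U : uniq emb by rewrite map_inj_uniq ?enum_uniq //; apply: fmorph_inj.
  have sub : {subset emb <= fixed_field K Q 1}.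
    by move=> _ /mapP [x _ ->]; rewrite mem_fixed_field // expn1 iotaQ.
  have [|_ ->] := uniq_min_size U sub; last by rewrite mem_fixed_field // expn1.
  by rewrite size_fixed_field // size_map -cardE expn1.
have embP y : y ^+ Q = y -> exists x, y = iota x.
  by move/eqP; rewrite -mem_emb => /mapP [x _ ->]; exists x.
have fixmap (p : {poly F}) : fixpoly Fr (map_poly iota p).
  by apply/eqP/polyP => i; rewrite !coef_map /= FrE iotaQ.
have [g g_prim] : exists g : K, (Q.-1).-primitive_root g.
  have in0 : 0 \in fixed_field K Q 1 by rewrite mem_fixed_field // expn1 expr0n gtn_eqF // ltnW.
  have : has (Q.-1).-primitive_root (rem 0 (fixed_field K Q 1)).
    apply: has_prim_root.
    - by rewrite -ltnS prednK // ltnW.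
    - apply/allP => x; rewrite mem_rem_uniq ?uniq_fixed_field // inE mem_fixed_field // expn1.
      case/andP => /= x0 /eqP xQ; apply/unity_rootP/(mulfI x0).
      by rewrite mulr1 -exprS prednK // ltnW.
    - by rewrite rem_uniq // uniq_fixed_field.
    - by rewrite size_rem // size_fixed_field // expn1.
  by case/hasP => g _; exists g.
have iota0 x : (iota x == 0) = (x == 0) by rewrite fmorph_eq0.
have M00 : M0 != 0 by rewrite -size_poly_eq0 sM0.
have A0 : A != 0 by apply: contra_neq M00 => A0; move: A_M0; rewrite A0 dvd0p => /eqP.
have B0 : B != 0 by apply: contra_neq M00 => B0; move: B_M0; rewrite B0 dvd0p => /eqP.
have rootsP (p : {poly F}) : p != 0 -> exists r : seq K, [/\ perm_eq (map Fr r) r,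
    forall y, root (map_poly iota p) y = (y \in r) &
    map_poly iota p = iota (lead_coef p) *: \prod_(a <- r) ('X - a%:P)].
  move=> p0; have [r rE] := closed_field_poly_normal (map_poly iota p).
  rewrite lead_coef_map in rE; exists r; split=> //.
    apply: prod_XsubC_eq; rewrite big_map.
    have l0 : (iota (lead_coef p))%:P != 0 by rewrite polyC_eq0 iota0 lead_coef_eq0.
    apply: (mulfI l0); rewrite !mul_polyC -rE -[RHS](eqP (fixmap p)) rE map_polyZ FrE iotaQ.
    by rewrite map_prod_XsubC.
  by move=> y; rewrite rE rootZ ?iota0 ?lead_coef_eq0 // root_prod_XsubC.
have [rA [rA_fix rA_root AE]] := rootsP A A0.
have [rB [rB_fix rB_root BE]] := rootsP B B0.
have evE (p : {poly F}) r x : map_poly iota p = iota (lead_coef p) *: \prod_(a <- r) ('X - a%:P) ->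
   iota p.[x] = iota (lead_coef p * (-1) ^+ size r) * \prod_(a <- r) (a - iota x).
  move=> pE; rewrite -horner_map pE hornerZ horner_prod rmorphM -mulrA /=; congr (_ * _).
  rewrite rmorphXn rmorphN1; elim: r {pE} => [|a r IH]; first by rewrite !big_nil mulr1.
  by rewrite !big_cons IH hornerXsubC exprS; ring.
(* Collects the leading coefficients and the signs from replacing [y - a] by [a - y]. *)
pose cF := (lead_coef A * (-1) ^+ size rA) ^+ w / (lead_coef B * (-1) ^+ size rB).
have c0 : iota cF != 0.
  by rewrite iota0 !mulf_neq0 ?invr_eq0 ?mulf_neq0 ?expf_neq0 ?mulf_neq0 ?expf_neq0 ?lead_coef_eq0 ?oppr_eq0 ?oner_eq0.
pose U := Uval rA rB w (iota cF).
have UE x : U (iota x) = iota (A.[x] ^+ w / B.[x]).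
  rewrite fmorph_div rmorphXn (evE A rA x AE) (evE B rB x BE) /U /Uval /cF fmorph_div rmorphXn exprMn invfM.
  by ring.
have subroot (p : {poly F}) y : p %| M0 -> root (map_poly iota p) y -> root (map_poly iota M0) y.
  by move=> /dvdpP [v ->]; rewrite rmorphM rootM => ->; rewrite orbT.
have cntB : count_mem rho rB = 1%N.
  apply/eqP; rewrite eqn_leq -has_count has_pred1 -rB_root rho_B andbT.
  rewrite -rho_M0 mup_geq ?map_poly_eq0 //.
  apply: (@dvdp_trans _ (map_poly iota B)); last by rewrite dvdp_map.
  rewrite BE dvdpZr ?iota0 ?lead_coef_eq0 // -mup_geq ?monic_neq0 ?monic_prod_XsubC //.
  by rewrite mu_prod_XsubC.
have e_dvd : (e %| Q.-1)%N by exact: dvdn_gcdr.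
have e_gt0 : (0 < e)%N by rewrite gcdn_gt0 kap_gt0.
have [om om_prim] := C_prim_root_exists e_gt0.
have omX a : (om ^+ a) ^+ e = 1 by rewrite exprAC (prim_expr_order om_prim) expr1n.
have Wb a : (0 < a < e)%N ->
    `|\sum_(y <- fixed_field K Q 1) chi Q.-1 g (om ^+ a) (U y)| <= D.-1%:R * sqrtC Q%:R.
  case/andP => a0 ae; apply: (weil_bound FrE Q_gt1 pcharQ g_prim e_dvd (omX a) _ w_gt0 c0 (iotaQ _) rA_fix rB_fix (M0 := map_poly iota M0) (rho := rho)) => //.
  - rewrite -(prim_order_dvd om_prim) gtnNdvd //.
  - by rewrite size_map_poly sM0.
  - by move=> x; rewrite -rA_root; apply: subroot.
  - by move=> x; rewrite -rB_root; apply: subroot.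
  - by rewrite -rA_root.
have [/existsP [y0 /existsP [x0 /and3P [? ? /eqP ?]]]|] := boolP
    [exists y : F, exists x : F, [&& M0.[y] != 0, x != 0 & x ^+ kap == A.[y] ^+ w / B.[y]]].
  by exists y0, x0.
rewrite negb_exists => /forallP nosol.
have M0_dvd0 (p : {poly F}) x : p %| M0 -> M0.[x] != 0 -> p.[x] != 0.
  by case/dvdpP => v ->; rewrite hornerM mulf_eq0 negb_or => /andP [].
have unitU y : y \in fixed_field K Q 1 -> ~~ root (map_poly iota M0) y ->
    exists x i, [/\ M0.[x] != 0, U y = g ^+ i & U y = iota (A.[x] ^+ w / B.[x])].
  rewrite mem_fixed_field // expn1 => /eqP /embP [x ->{y}] rx.
  have Mx : M0.[x] != 0 by rewrite -iota0 -horner_map.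
  have /orP [|/eqP/(prim_rootP g_prim) [i Ui]] := fixed_unit Q_gt1 (iotaQ (A.[x] ^+ w / B.[x])).
    by rewrite iota0 mulf_eq0 invr_eq0 expf_eq0 w_gt0 !(negPf (M0_dvd0 _ _ _ Mx)).
  by exists x, i; rewrite UE.
have om_norm a i : `|(om ^+ a) ^+ i| = 1.
  have : `|om| ^+ e = 1 by rewrite -normrX (prim_expr_order om_prim) normr1.
  by move/eqP; rewrite pexpr_eq1 // => /eqP; rewrite !normrX => ->; rewrite !expr1n.
have orth y : y \in fixed_field K Q 1 -> ~~ root (map_poly iota M0) y ->
    \sum_(a < e) chi Q.-1 g (om ^+ a) (U y) = 0.
  move=> yF yM; have [x [i [Mx Ui Ux]]] := unitU y yF yM.
  have omi : om ^+ i != 1.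
    (* If [e] divides [i], a Bezout relation for [kap] and [Q.-1] writes [g ^+ i] as a [kap]-th
       power, giving a solution. *)
    rewrite -(prim_order_dvd om_prim); apply/negP => /dvdnP [j ij].
    have [km kn kmE _] := egcdnP Q.-1 kap_gt0.
    have gX : (g ^+ (km * j)) ^+ kap = U y.
      rewrite Ui ij -exprM mulnAC kmE mulnDl -/e [(j * e)%N]mulnC exprD.
      by rewrite mulnAC mulnC exprM (prim_expr_order g_prim) expr1n mul1r.
    have gQ : (g ^+ (km * j)) ^+ Q = g ^+ (km * j).
      rewrite -exprM mulnC exprM -[in X in (X ^+ _)](prednK (ltnW Q_gt1)) exprS.
      by rewrite (prim_expr_order g_prim) mulr1.
    have [t tE] := embP _ gQ.
    have := nosol x; rewrite negb_exists => /forallP /(_ t) /negP; apply.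
    rewrite Mx -iota0 -tE expf_neq0 ?(prim_root_eq0 g_prim) -?lt0n ?(prim_order_gt0 g_prim) //=.
    by apply/eqP/(fmorph_inj iota); rewrite rmorphXn -tE -Ux.
  have : (om ^+ i - 1) * \sum_(a < e) chi Q.-1 g (om ^+ a) (U y) = 0.
    rewrite (eq_bigr (fun a : 'I_e => (om ^+ i) ^+ a)) => [|a _].
      by rewrite -subrX1 exprAC (prim_expr_order om_prim) expr1n subrr.
    by rewrite Ui (chi_expg g_prim (om_expQ e_dvd (omX a))) exprAC.
  by move/eqP; rewrite mulf_eq0 subr_eq0 (negPf omi) => /eqP.
have chi_le1 a y : `|chi Q.-1 g (om ^+ a) y| <= 1.
  by rewrite /chi; case: pickP => [i _|_]; rewrite ?om_norm ?normr0.
pose nM := count (root (map_poly iota M0)) (fixed_field K Q 1).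
have nM_le : (nM <= D)%N.
  rewrite -ltnS -sM0 -(size_map_poly iota) /nM -size_filter.
  apply: max_poly_roots; rewrite ?map_poly_eq0 ?filter_all //.
  by rewrite filter_uniq // uniq_fixed_field.
have total : `|\sum_(a < e) \sum_(y <- fixed_field K Q 1) chi Q.-1 g (om ^+ a) (U y)| <= (e * nM)%:R.
  rewrite exchange_big (le_trans (ler_norm_sum _ _ _)) //.
  rewrite /nM -sum_nat_count big_distrr natr_sum /= big_seq [leRHS]big_seq.
  apply: ler_sum => y yF; have [yM|yM] := boolP (root _ y); last first.
    by rewrite orth // normr0 muln0.
  rewrite muln1 (le_trans (ler_norm_sum _ _ _)) //.
  rewrite -[X in _ <= X%:R]card_ord -sum1_card natr_sum; apply: ler_sum => a _; exact: chi_le1.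
have triv : (Q - nM)%:R <= `|\sum_(y <- fixed_field K Q 1) chi Q.-1 g (om ^+ 0) (U y)|.
  have chi01 y : 0 <= chi Q.-1 g (om ^+ 0) y.
    by rewrite /chi; case: pickP => [i _|_]; rewrite ?expr0 ?expr1n ?ler01.
  rewrite ger0_norm; last by apply: sumr_ge0.
  have -> : (Q - nM)%N = (\sum_(y <- fixed_field K Q 1) ~~ root (map_poly iota M0) y)%N.
    rewrite sum_nat_count -{1}(expn1 Q) -(size_fixed_field K Q_gt1 (i := 1)) //.
    by rewrite -(count_predC (root (map_poly iota M0))) addKn.
  rewrite natr_sum big_seq [leRHS]big_seq; apply: ler_sum => y yF.
  have [yM|yM] := boolP (root _ y) => //=.
  have [x [i [_ -> _]]] := unitU y yF yM.
  by rewrite expr0 (chi_expg g_prim) expr1n.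
(* The at most [D] zeros of [M0] in [F] cost [e] each in the total and one more each in the trivial
   sum. *)
have fin : Q%:R <= (e.+1 * D)%:R + (e.-1 * D.-1)%:R * sqrtC Q%:R :> algC.
  have nQ : (nM <= Q)%N by rewrite -(expn1 Q) -(size_fixed_field K Q_gt1 (i := 1)) // count_size.
  pose G a := \sum_(y <- fixed_field K Q 1) chi Q.-1 g (om ^+ a) (U y).
  have spl : \sum_(a < e) G a = G 0%N + \sum_(a < e.-1) G a.+1.
    by case: (e) e_gt0 => // e1 _; rewrite big_ord_recl.
  have rest : `|\sum_(a < e.-1) G a.+1| <= (e.-1 * D.-1)%:R * sqrtC Q%:R.
    rewrite (le_trans (ler_norm_sum _ _ _)) //.
    rewrite natrM -mulrA -[X in X%:R * _]card_ord -sum1_card natr_sum big_distrl /=.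
    apply: ler_sum => a _; rewrite mul1r; apply: Wb => /=.
    by rewrite -[X in (_ < X)%N](prednK e_gt0) ltnS ltn_ord.
  have G0 : G 0%N = \sum_(a < e) G a - \sum_(a < e.-1) G a.+1 by rewrite spl addrK.
  rewrite -[in leLHS](subnK nQ) natrD.
  apply: (@le_trans _ _ ((e * nM)%:R + (e.-1 * D.-1)%:R * sqrtC Q%:R + nM%:R)).
    rewrite lerD2r (le_trans triv) // -/(G 0%N) G0.
    by apply: le_trans (ler_normB _ _) _; apply: lerD.
  rewrite addrAC lerD2r -natrD ler_nat -mulSnr.
  by rewrite leq_mul2l nM_le orbT.
pose r : algC := sqrtC Q%:R.
have r2 : Q%:R = r * r by rewrite -expr2 sqrtCK.
have r0 : 0 <= r by rewrite sqrtC_ge0 ler0n.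
have mr : (e.+1 * D.+1)%:R <= r.
  rewrite -(ler_pXn2r (n := 2)) ?nnegrE ?ler0n // sqrtCK -natrX ler_nat; exact: bound.
suff : Q%:R < r * r by rewrite -r2 ltxx.
apply: (le_lt_trans fin); rewrite -/r.
(* With [r] the square root of [Q], [mr] bounds [e.+1 * D] by [r], and [(e.-1 * D.-1).+1] is still
   less than [r]. *)
apply: (@le_lt_trans _ _ ((e.-1 * D.-1).+1%:R * r)).
  rewrite -[in leRHS]addn1 natrD mulrDl mul1r addrC lerD2l (le_trans _ mr) // ler_nat.
  by rewrite leq_mul2l leqnSn orbT.
rewrite ltr_pM2r // (lt_le_trans _ mr) // ltr_nat.
rewrite mulSn mulnS addSn ltnS.
apply: leq_ltn_trans (leq_mul (leq_pred e) (leq_pred D)) _.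
by rewrite addnA -[X in (X < _)%N]add0n ltn_add2r addn_gt0 e_gt0 orbT.
Qed.
End PowerValue.

(** * Linearized polynomials *)

Lemma mup_simple_root (K : fieldType) (p : {poly K}) (rho : K) :
  root p rho -> p^`().[rho] != 0 -> mup rho p = 1%N.
Proof.
move=> pr dp; have p0 : p != 0 by apply: contra_neq dp => ->; rewrite deriv0 horner0.
apply/eqP; rewrite eqn_leq mup_leq // -XsubC_dvd // dvdp_XsubCl pr andbT.
apply: contra dp => /dvdpP [v ->]; rewrite expr2 !derivM derivXsubC mul1r mulr1 -mulr2n.
have z0 : ('X - rho%:P).[rho] = 0 by rewrite hornerXsubC subrr.
by rewrite hornerD !hornerM hornerMn z0 mul0rn !mulr0 addr0.
Qed.

Section QPolynomial.
Variables (F : fieldType) (q d : nat) (b : nat -> F).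
Hypotheses (q_gt1 : (1 < q)%N) (q0 : q%:R = 0 :> F).

Definition qpoly : {poly F} := \sum_(i < d.+1) b i *: 'X^(q ^ i).
Definition qpoly_divX : {poly F} := \sum_(i < d.+1) b i *: 'X^((q ^ i).-1).

Lemma qpoly_XM : qpoly = 'X * qpoly_divX.
Proof.
rewrite /qpoly big_distrr; apply: eq_bigr => i _ /=.
by rewrite -scalerAr -exprS prednK // expn_gt0 ltnW.
Qed.

Lemma horner_qpoly y : qpoly.[y] = fq_sum q d b y.
Proof. by rewrite horner_sum; apply: eq_bigr => i _; rewrite hornerZ hornerXn. Qed.

Lemma deriv_Xq i : (0 < i)%N -> ('X^(q ^ i) : {poly F})^`() = 0.
Proof.
case: i => // i _; rewrite derivXn -mulr_natr; apply/eqP.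
by rewrite mulf_eq0 -polyC_natr expnS natrM q0 mul0r eqxx orbT.
Qed.

Lemma deriv_qpoly : qpoly^`() = (b 0)%:P.
Proof.
rewrite /qpoly big_ord_recl derivD raddf_sum big1 => [|i _].
  by rewrite addr0 derivZ expn0 expr1 derivX alg_polyC.
by rewrite /= derivZ deriv_Xq // scaler0.
Qed.

Lemma size_qpoly_leq : (size qpoly <= (q ^ d).+1)%N.
Proof.
apply: leq_trans (size_sum _ _ _) _; apply/bigmax_leqP => i _.
apply: leq_trans (size_scale_leq _ _) _.
by rewrite size_polyXn ltnS leq_exp2l // -ltnS.
Qed.

Lemma size_qpoly : b d != 0 -> size qpoly = (q ^ d).+1.
Proof.
move=> bd; apply/eqP; rewrite eqn_leq size_qpoly_leq /=.
rewrite ltnNge; apply: contra bd => /leq_sizeP /(_ _ (leqnn _)).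
rewrite coef_sum (bigD1 ord_max) //= coefZ coefXn eqxx mulr1 big1 ?addr0 => [->|i ne] //.
rewrite coefZ coefXn eqn_exp2l // gtn_eqF ?mulr0 // ltn_neqAle -ltnS ltn_ord andbT.
by apply: contra ne => /eqP e; apply/eqP/val_inj.
Qed.

Lemma qpoly_divX0 : qpoly_divX.[0] = b 0.
Proof.
rewrite horner_sum big_ord_recl hornerZ hornerXn expr0 mulr1 big1 ?addr0 // => i _.
rewrite hornerZ hornerXn expr0n gtn_eqF ?mulr0 //=.
by rewrite -ltnS prednK ?expn_gt0 ?(ltnW q_gt1) // -(expn0 q) ltn_exp2l.
Qed.
End QPolynomial.

(** * The case of a nonzero linear coefficient *)

Section Binomial.
Variables (q n : nat) (F : finFieldType).
Hypotheses (HF : #|F| = (q ^ n)%N) (q_gt1 : (1 < q)%N) (q0 : q%:R = 0 :> F).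
Hypothesis pcharF : [pchar F].-nat #|F|.
Variables (alpha beta : F) (k d h : nat) (b : nat -> F).
Hypotheses (alpha0 : alpha != 0) (k_gt0 : (0 < k)%N) (d_gt0 : (0 < d)%N) (h_gt0 : (0 < h)%N).
Hypotheses (b0 : b 0%N != 0) (bd : b d != 0).
(** [q ^ M] bounds the degree of [f] and, for [beta != 0], that of ['X^(q ^ h) - beta *: f]. *)
Let M := if beta == 0 then d else maxn h d.
Hypothesis bound : (2 * (k + M + 1) <= n)%N.

(** Division by [x] turns the equation into one for [x ^+ (q ^ k - 1)]. The pole [rho] is a nonzero
    root of [f], simple because the derivative of [f] is a nonzero constant; the numerator is a
    power of [rho] there. *)
Lemma binomial_value : exists y x : F, [/\ y != 0, x != 0, fq_sum q d b y != 0 &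
  gbin q k alpha beta x = x * (y ^+ (q ^ h) / fq_sum q d b y)].
Proof.
have [K [iota _]] := countable_algebraic_closure F.
pose f := qpoly q d b; pose f2 := qpoly_divX q d b.
have fE : f = 'X * f2 := qpoly_XM d b q_gt1.
have f0 : f != 0 by rewrite -size_poly_eq0 size_qpoly.
have f20 : f2 != 0 by apply: contra_neq f0 => f20; rewrite fE f20 mulr0.
have sf2 : size f2 = (q ^ d)%N.
  by have := size_qpoly q_gt1 bd; rewrite -/f fE mulrC size_mulX // => -[].
have q_pow j : (0 < j)%N -> (1 < q ^ j)%N.
  by case: j => // j _; rewrite (leq_trans q_gt1) // expnS leq_pmulr // expn_gt0 ltnW.
have [rho f2rho] : exists rho : K, root (map_poly iota f2) rho.
  by apply/closed_rootP; rewrite size_map_poly sf2 gtn_eqF // q_pow.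
have f2_at0 : f2.[0] != 0 by rewrite (qpoly_divX0 d b q_gt1).
have iota0 x : (iota x == 0) = (x == 0) by rewrite fmorph_eq0.
have rho0 : rho != 0.
  apply: contraNneq f2_at0 => rho0; move: f2rho.
  by rewrite rho0 => /rootP; rewrite -(rmorph0 iota) horner_map => /fmorph_inj ->.
have f_rho : root (map_poly iota f) rho by rewrite fE rmorphM rootM f2rho orbT.
have f_simple : mup rho (map_poly iota f) = 1%N.
  apply: mup_simple_root => //.
  by rewrite deriv_map (deriv_qpoly d b q0) map_polyC hornerC /= iota0.
have f2_simple : mup rho (map_poly iota f2) = 1%N.
  by rewrite -f_simple fE rmorphM /= map_polyX mupMr // rootX.
have q1_gt0 : (0 < q ^ k - 1)%N by rewrite subn_gt0 q_pow.
have qk : (q ^ k = (q ^ k - 1).+1)%N by rewrite subn1 prednK // expn_gt0 ltnW.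
(* From [2 <= q] and [gcdn (q ^ k - 1) #|F|.-1 < q ^ k], the base is at most [q ^ (k + M + 1)]. *)
have bnd D : (D.+1 <= 2 * q ^ M)%N ->
   (((gcdn (q ^ k - 1) #|F|.-1).+1 * D.+1) ^ 2 <= #|F|)%N.
  move=> sD; rewrite HF.
  apply: (@leq_trans (q ^ (2 * (k + M + 1)))); last by rewrite leq_exp2l.
  rewrite [(2 * _)%N]mulnC expnM leq_exp2r // !expnD expn1 -mulnA leq_mul //.
    by rewrite [leqRHS]qk ltnS dvdn_leq // dvdn_gcdl.
  by apply: leq_trans sD _; rewrite mulnC leq_mul2l q_gt1 orbT.
have root_af : root (map_poly iota (alpha *: f)) rho.
  by rewrite map_polyZ rootZ ?iota0.
have fin (A : {poly F}) w y x : y != 0 -> x != 0 -> f.[y] != 0 ->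
    A.[y] ^+ w = y ^+ (q ^ h) - beta * f.[y] ->
    x ^+ (q ^ k - 1) = A.[y] ^+ w / (alpha *: f).[y] ->
    exists y x : F, [/\ y != 0, x != 0, fq_sum q d b y != 0 &
      gbin q k alpha beta x = x * (y ^+ (q ^ h) / fq_sum q d b y)].
  move=> y0 x0 fy Ay xk; exists y, x; rewrite -horner_qpoly -/f; split=> //.
  rewrite /gbin qk exprS xk Ay hornerZ; field.
  by rewrite alpha0 fy.
have [beta0|beta0] := eqVneq beta 0.
  (* The numerator is the [q ^ h]-th power of ['X], so the modulus is [f] itself and its degree does
     not involve [h]. *)
  have [|||||||||y [x [My x0 xk]]] := @power_value F K iota (q ^ k - 1) (q ^ h) 'X (alpha *: f) f (q ^ d) rho pcharF => //.
  - by rewrite expn_gt0 ltnW.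
  - exact: size_qpoly.
  - by rewrite fE dvdp_mulr.
  - by rewrite dvdpZl.
  - by rewrite map_polyX rootX.
  - by apply: bnd; rewrite /M beta0 eqxx mul2n -addnn -addn1 leq_add2l expn_gt0 ltnW.
  apply: (fin 'X (q ^ h)%N y x) => //.
    by apply: contra_neq My => ->; rewrite fE hornerM hornerX mul0r.
  by rewrite hornerX beta0 mul0r subr0.
pose A := 'X^(q ^ h) - beta *: f.
have A0 : A != 0.
  apply: contraNneq (mulf_neq0 beta0 b0) => A0.
  have : A^`().[0] = 0 by rewrite A0 deriv0 horner0.
  rewrite /A derivB deriv_Xq // derivZ deriv_qpoly // sub0r hornerN hornerZ hornerC.
  by move/eqP; rewrite oppr_eq0.
have sA : (size A <= (q ^ M).+1)%N.
  apply: leq_trans (size_polyD _ _) _; rewrite geq_max size_polyN size_polyXn ltnS.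
  rewrite /M (negPf beta0) leq_exp2l // leq_maxl /=.
  apply: leq_trans (size_scale_leq _ _) _; apply: leq_trans (size_qpoly_leq d b q_gt1) _.
  by rewrite ltnS leq_exp2l // leq_maxr.
have sM0 : size (A * f2) = (size (A * f2)).-1.+1.
  by rewrite prednK // size_poly_gt0 mulf_neq0.
have rho_A : ~~ root (map_poly iota A) rho.
  rewrite /A rmorphB /= map_polyXn map_polyZ /root hornerD hornerN hornerZ.
  by rewrite (rootP f_rho) mulr0 subr0 hornerXn expf_neq0.
(* Since ['X] divides [A], the product [A * f2] is already a multiple of [f]. Its size is at most
   [2 * q ^ M], as [bnd] demands; for [A * f] the estimate would be one larger. *)
have [|||||||||y [x [My x0 xk]]] := @power_value F K iota (q ^ k - 1) 1 A (alpha *: f) (A * f2) (size (A * f2)).-1 rho pcharF => //.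
- exact: dvdp_mulr.
- rewrite dvdpZl // fE dvdp_mul // -['X]subr0 -[0 in X in X %| _]/(0%:P) dvdp_XsubCl.
  rewrite /A /root hornerD hornerN hornerZ hornerXn fE hornerM hornerX mul0r mulr0 subr0.
  by rewrite expr0n gtn_eqF // expn_gt0 ltnW.
- by rewrite rmorphM mupMr.
- apply: bnd; rewrite -sM0 size_mul // sf2.
  apply: leq_trans (_ : ((q ^ M).+1 + q ^ M).-1 <= _)%N; last by rewrite addSn addnn mul2n.
  rewrite -!subn1 leq_sub2r // leq_add // leq_exp2l //.
  by rewrite /M (negPf beta0) leq_maxr.
move: My; rewrite hornerM mulf_eq0 negb_or => /andP [Ay f2y].
have y0 : y != 0.
  apply: contraNneq Ay => ->.
  rewrite /A hornerD hornerN hornerZ hornerXn fE hornerM hornerX mul0r mulr0 subr0.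
  by rewrite expr0n gtn_eqF // expn_gt0 ltnW.
apply: (fin A 1%N y x) => //; first by rewrite fE hornerM hornerX mulf_neq0.
by rewrite expr1 /A hornerD hornerN hornerZ hornerXn.
Qed.
End Binomial.

(** * Reduction to a nonzero linear coefficient *)

Theorem theorem3p15
  (q n : nat) (F : finFieldType)
  (Hq : exists p e : nat, [/\ prime p, (0 < e)%N & q = (p ^ e)%N])
  (Hn : (2 <= n)%N) (HF : #|F| = (q ^ n)%N)
  (alpha beta : F) (k : nat) (d : nat) (a : nat -> F) (h : nat)
  (Halpha : alpha != 0) (Hk : (1 <= k < n)%N)
  (Hd : (d < n)%N) (Had : a d != 0) (Hsupp : forall i, (d < i)%N -> a i = 0)
  (Hnotmono : exists2 i, (i < d)%N & a i != 0)
  (Hh : (ell a d < h < n)%N)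
  (Hbound : (2 * (k + maxn (m_h a d h beta) d - ell a d + 1) <= n)%N) :
  exists x y : F, [/\ x != 0, y != 0 &
    same_point x (gbin q k alpha beta x) (fq_sum q d a y) (y ^+ (q ^ h)%N)].
Proof.
case: Hq => p [e [p_pr e_gt0 qE]].
have q_gt1 : (1 < q)%N by rewrite qE -(exp1n e) ltn_exp2r // prime_gt1.
have pF : p \in [pchar F] by apply: (@card_finPcharP F p (e * n)%N) => //; rewrite HF qE expnM.
have q0 : q%:R = 0 :> F by rewrite qE natrX (pcharf0 pF) expr0n gtn_eqF.
have pcharF : [pchar F].-nat #|F|.
  by rewrite (eq_pnat _ (pcharf_eq pF)) HF qE -expnM pnatX pnat_id.
pose l := ell a d; rewrite -/l in Hh Hbound.
have [i0 i0d ai0] := Hnotmono.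
have hasa : has (fun i => a i != 0) (iota 0 d.+1).
  by apply/hasP; exists d; rewrite ?mem_iota ?add0n ?ltnSn.
have lE i : (i < d.+1)%N -> nth 0%N (iota 0 d.+1) i = i by move=> lt; rewrite nth_iota.
have l_d : (l < d)%N.
  rewrite ltnNge; apply/negP => dl; have := @before_find _ 0%N (fun i => a i != 0) (iota 0 d.+1) i0.
  by rewrite -/(ell a d) -/l (leq_trans i0d dl) lE ?ai0 ?ltnS ?(ltnW i0d) // => /(_ isT).
have al : a l != 0.
  by have := nth_find 0%N hasa; rewrite -/(ell a d) -/l lE // ltnS ltnW.
have a_lt i : (i < l)%N -> a i = 0.
  move=> il; have := @before_find _ 0%N (fun i => a i != 0) (iota 0 d.+1) i il.
  by rewrite lE ?(ltn_trans (ltn_trans il l_d)) // => /negbT; rewrite negbK => /eqP.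
have /andP [lh hn] := Hh; have /andP [k_gt0 kn] := Hk.
pose b i := a (l + i)%N.
(* For [beta != 0], [maxn (m_h a d h beta) d] is at least [maxn h d] in both cases, since the
   exceptional one has [h = d]. *)
have bound : (2 * (k + (if beta == 0%R then (d - l) else maxn (h - l) (d - l)) + 1) <= n)%N.
  apply: leq_trans Hbound; rewrite leq_mul2l /= leq_add2r -addnBA; last first.
    by rewrite leq_max (ltnW l_d) orbT.
  rewrite leq_add2l /m_h; case: eqP => _; first by rewrite leq_sub2r // leq_maxr.
  rewrite -subn_maxl leq_sub2r // geq_max leq_maxr andbT.
  case: ifP => [_|/negbT]; first by rewrite !leq_max leqnn orbT.
  by rewrite negb_or negbK => /andP [/eqP -> _]; rewrite leq_maxr.
have [||||w [x [w0 x0 fw gx]]] := @binomial_value q n F HF q_gt1 q0 pcharF alpha beta k (d - l) (h - l) b Halpha k_gt0 _ _ _ _ bound.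
- by rewrite subn_gt0.
- by rewrite subn_gt0.
- by rewrite /b addn0.
- by rewrite /b subnKC // ltnW.
(* As [F] has [q ^ n] elements, this is the [q ^ l]-th root of [w]. *)
pose y := w ^+ (q ^ (n - l)).
have yl : y ^+ (q ^ l) = w.
  by rewrite -exprM -expnD subnK ?(ltnW (ltn_trans l_d Hd)) // -HF expf_card.
have fy : fq_sum q d a y = fq_sum q (d - l) b w.
  rewrite /fq_sum -(subnKC (leq_trans (ltnW l_d) (leqnSn d))) subSn ?(ltnW l_d) //.
  rewrite big_split_ord /= big1 => [|i _]; last by rewrite a_lt ?mul0r.
  by rewrite add0r; apply: eq_bigr => i _; rewrite expnD exprM yl.
have yh : y ^+ (q ^ h) = w ^+ (q ^ (h - l)).
  by rewrite -{1}(subnKC (ltnW lh)) expnD exprM yl.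
exists x, y; split=> //; first by rewrite expf_neq0.
exists (x / fq_sum q (d - l) b w); rewrite fy yh; split; last split.
- by rewrite mulf_neq0 ?invr_eq0.
- by rewrite divfK.
- by rewrite gx; ring.
Qed.
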